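(* In the setting described in the context, for all $s,\beta>0$ there exists a constant $C_{s,\beta}>0$ such that for all $f\in L^2(\Omega,\mu)$, $$\big\||x|^{s}f\big\|^{\frac{2\beta}{s+\beta}}_{L^2(\Omega,\mu)}\;\big\||\xi|^{\beta}\mathcal T(f)\big\|^{\frac{2s}{s+\beta}}_{L^2(\widehat\Omega,\widehat\mu)}\ge C_{s,\beta}\,\|f\|^2_{L^2(\Omega,\mu)}.$$
   Context: Let $\Omega,\widehat\Omega\subset\mathbb R^d$ be convex cones ($\lambda x$ stays in the cone for $x$ in the cone and $\lambda>0$) with non-empty interior, endowed with Borel measures $\mu,\widehat\mu$, absolutely continuous with respect to Lebesgue measure, with polar decompositions $d\mu(r\zeta)=r^{2a-1}\,dr\,Q(\zeta)\,d\sigma(\zeta)$ and $d\widehat\mu(r\zeta)=r^{2\widehat a-1}\,dr\,\widehat Q(\zeta)\,d\sigma(\zeta)$, where $\sigma$ is the surface measure on the unit sphere $\mathbb S^{d-1}$, $Q,\widehat Q\in L^1(\mathbb S^{d-1},d\sigma)$ are nonnegative and not identically zero, and $\widehat a=a>0$. Let $\mathcal K:\Omega\times\widehat\Omega\to\mathbb C$ be a kernel that is continuous, polynomially bounded: $|\mathcal K(x,\xi)|\le c_{\mathcal T}(1+|x|)^m(1+|\xi|)^{\widehat m}$ (with $m,\widehat m\ge0$), and homogeneous: $\mathcal K(\lambda x,\xi)=\mathcal K(x,\lambda\xi)$ for $\lambda>0$. Define the integral operator $$\mathcal T(f)(\xi)=\int_\Omega f(x)\mathcal K(x,\xi)\,d\mu(x),\qquad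 \xi\in\widehat\Omega,$$ on $\mathcal S(\Omega)$ (Schwartz functions on $\Omega$). For $\rho\ge0$ put $d\mu_\rho(x)=(1+|x|)^\rho d\mu(x)$, $d\widehat\mu_\rho(\xi)=(1+|\xi|)^\rho d\widehat\mu(\xi)$; the same integral defines $\mathcal T(f)$ for $f\in L^1(\Omega,\mu_m)$. Assume: (Inversion Formula) if $f\in L^1(\Omega,\mu_m)$ and $\mathcal T(f)\in L^1(\widehat\Omega,\widehat\mu_{\widehat m})$, then $f$ is (a.e. equal to) a continuous function with $\sup_x |f(x)|/(1+|x|)^m<\infty$ and $f(x)=\int_{\widehat\Omega}\mathcal T(f)(\xi)\overline{\mathcal K(x,\xi)}\,d\widehat\mu(\xi)$ for $x\in\Omega$; (Plancherel) $\|\mathcal T(f)\|_{L^2(\widehat\Omega,\widehat\mu)}=\|f\|_{L^2(\Omega,\mu)}$ for $f\in\mathcal S(\Omega)$, and $\mathcal T$ extends uniquely to a unitary operator from $L^2(\Omega,\mu)$ onto $L^2(\widehat\Omega,\widehat\mu)$, still denoted $\mathcal T$. Weighted norms are allowed to be $+\infty$. *)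

(* Defs.v *)
From HB Require Import structures.
From mathcomp Require Import all_boot all_order all_algebra.
From mathcomp Require Import all_classical all_reals all_analysis.
From mathcomp Require Import measurable_realfun complex lra.

Set Implicit Arguments.
Unset Strict Implicit.
Unset Printing Implicit Defensive.

Import Order.TTheory GRing.Theory Num.Theory.
Import numFieldNormedType.Exports.

Local Open Scope classical_set_scope.
Local Open Scope ring_scope.
Local Open Scope complex_scope.

Definition borel (T : ptopologicalType) : measurableType (sigma_display (@open T)) :=
  g_sigma_algebraType (@open T).

Section borel_rV.
Context {R : realType}.

Let box n (p : {ffun 'I_n -> rat} * nat) : set 'rV[R]_n :=
  [set x | forall i, `|x ord0 i - ratr (p.1 i)| < p.2.+1%:R^-1].

Let open_bigcup_box n (U : set 'rV[R]_n) : open U ->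
  U = \bigcup_k (if unpickle k is Some p then
                   if `[< box p `<=` U >] then box p else set0
                 else set0).
Proof.
move=> oU; apply/seteqP; split => [x Ux|x [k _]]; last first.
  by case: unpickle => // p; case: asboolP => // + px; exact.
have /nbhs_ballP[e /= e0 xeU] : nbhs x U by exact: open_nbhs_nbhs.
have [k ke] : exists k : nat, k.+1%:R^-1 < e / 2.
  have [k _ /(_ k (leqnn _)) kP] :=
    near_infty_natSinv_lt (PosNum (divr_gt0 e0 (ltr0Sn _ 1))).
  by exists k.
have k0 : 0 < k.+1%:R^-1 :> R by [].
pose r : R := k.+1%:R^-1; rewrite -/r in ke k0.
have q_ i : {q : rat | `|x ord0 i - ratr q| < r}.
  apply: cid; have /rat_in_itvoo[q] : x ord0 i - r < x ord0 i + r by lra.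
  rewrite in_itv/= => /andP[h1 h2]; exists q.
  by rewrite ltr_norml; apply/andP; split; lra.
pose p : {ffun 'I_n -> rat} * nat := ([ffun i => projT1 (q_ i)], k).
have px : box p x by move=> i /=; rewrite ffunE; exact: (projT2 (q_ i)).
exists (pickle p) => //; rewrite pickleK.
case: asboolP => // -[] y py; apply: xeU; split => // a i.
rewrite (ord1 a) /ball/=.
have -> : x ord0 i - y ord0 i =
  (x ord0 i - ratr (p.1 i)) - (y ord0 i - ratr (p.1 i)) by lra.
rewrite (le_lt_trans (ler_normB _ _))//.
by have := px i; have := py i; rewrite -/r; lra.
Qed.

Lemma measurable_rV_coord n (i : 'I_n) :
  measurable_fun [set: borel 'rV[R]_n] (fun x : 'rV[R]_n => x ord0 i).
Proof.
apply: (measurability _ (RGenOpens.measurableE R)) => //.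
move=> _ [_ [a [b ->]] <-]; rewrite setTI; apply: sub_sigma_algebra.
by apply: open_comp => [x _|]; [exact: coord_continuous|exact: interval_open].
Qed.

Lemma measurable_fun_rV d (T : measurableType d) n (f : T -> 'rV[R]_n) :
  (forall i, measurable_fun setT (fun x => f x ord0 i)) ->
  measurable_fun setT (f : T -> borel 'rV[R]_n).
Proof.
move=> mf; apply: (@measurability _ _ _ (borel 'rV[R]_n) _ _ open) => //.
move=> _ [U oU <-]; rewrite setTI (open_bigcup_box oU) preimage_bigcup.
apply: bigcupT_measurable => k.
case: unpickle => [p|]; last by rewrite preimage_set0.
case: asboolP => _; last by rewrite preimage_set0.
have -> : f @^-1` box p =
    \bigcap_(i in [set: 'I_n])
      [set x | `|f x ord0 i - ratr (p.1 i)| < p.2.+1%:R^-1].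
  by apply/seteqP; split => [x fx i _|x fx i]; exact: fx.
apply: fin_bigcap_measurable => // i _.
have mg : measurable_fun setT (fun x => `|f x ord0 i - ratr (p.1 i)|).
  by apply: measurableT_comp => //; exact: measurable_funB.
have := mg measurableT [set` `]-oo, p.2.+1%:R^-1[] (measurable_itv _).
by rewrite setTI set_itvE.
Qed.
End borel_rV.

Section lebesgue_rV.
Context {R : realType}.
Local Open Scope ereal_scope.

Let consv n (p : R * 'rV[R]_n) : 'rV[R]_n.+1 :=
  \row_j (if unlift ord0 j is Some i then p.2 ord0 i else p.1)%R.

Let tailv n (v : 'rV[R]_n.+1) : R * 'rV[R]_n :=
  (v ord0 ord0, \row_i v ord0 (lift ord0 i)).

Let consvK n : cancel (@consv n) (@tailv n).
Proof.
move=> [t v]; rewrite /tailv /consv; congr (_, _).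
  by rewrite mxE unlift_none.
by apply/rowP => i; rewrite !mxE liftK.
Qed.

Let measurable_consv n :
  measurable_fun setT (@consv n : measurableTypeR R * borel 'rV[R]_n -> borel 'rV[R]_n.+1).
Proof.
apply: (@measurable_fun_rV R _ (measurableTypeR R * borel 'rV[R]_n)%type _ (@consv n)) => j.
case: (unliftP ord0 j) => [i ->|->].
  rewrite (_ : (fun _ => _) = (fun v : 'rV[R]_n => v ord0 i) \o snd).
    by apply: (@measurableT_comp _ _ _ _ (borel 'rV[R]_n) _
      (fun v : 'rV[R]_n => v ord0 i) _ snd);
      [exact: measurable_rV_coord|exact: measurable_snd].
  by apply/funext => p; rewrite mxE liftK.
rewrite (_ : (fun _ => _) = fst); first exact: measurable_fst.
by apply/funext => p; rewrite mxE unlift_none.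
Qed.

Let measurable_tailv n :
  measurable_fun setT (@tailv n : borel 'rV[R]_n.+1 -> measurableTypeR R * borel 'rV[R]_n).
Proof.
apply/measurable_fun_pair => /=; first exact: measurable_rV_coord.
apply: (@measurable_fun_rV R _ (borel 'rV[R]_n.+1)) => i.
by under eq_fun do rewrite mxE; exact: measurable_rV_coord.
Qed.

Section step.
Variables (n : nat) (mu : {sigma_finite_measure set (borel 'rV[R]_n) -> \bar R}).

(* Lebesgue measure on R^(n+1), given Lebesgue measure [mu] on R^n: the product
   measure transported along R * R^n ~ R^(n+1). *)
Definition lebesgue_step : set (borel 'rV[R]_n.+1) -> \bar R :=
  pushforward (@lebesgue_measure R \x mu)
    (@consv n : measurableTypeR R * borel 'rV[R]_n -> borel 'rV[R]_n.+1).

Let lebesgue_step0 : lebesgue_step set0 = 0.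
Proof. by rewrite /lebesgue_step /pushforward preimage_set0 measure0. Qed.

Let lebesgue_step_ge0 A : 0 <= lebesgue_step A.
Proof. exact: measure_ge0. Qed.

Let lebesgue_step_sigma_additive : semi_sigma_additive lebesgue_step.
Proof.
exact: (@measure_semi_sigma_additive _ _ _
  (measure_function_pushforward__canonical__measure_function_Measure
    (@lebesgue_measure R \x mu) (@measurable_consv n))).
Qed.

HB.instance Definition _ := isMeasure.Build _ _ _ lebesgue_step
  lebesgue_step0 lebesgue_step_ge0 lebesgue_step_sigma_additive.

Let lebesgue_step_sigma_finite : sigma_finite setT lebesgue_step.
Proof.
have /sigma_finiteP[F [TF ndF Foo]] := sigma_finiteT (@lebesgue_measure R).
have /sigma_finiteP[G [TG ndG Goo]] := sigma_finiteT mu.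
exists (fun k => @tailv n @^-1` (F k `*` G k)).
  apply/esym; rewrite -subTset => v _.
  have [[k _ Fk] [l _ Gl]] : (\bigcup_i F i) (tailv v).1 /\
      (\bigcup_i G i) (tailv v).2 by rewrite -TF -TG.
  exists (maxn k l) => //; split.
    by move: Fk; exact/subsetPset/ndF/leq_maxl.
  by move: Gl; exact/subsetPset/ndG/leq_maxr.
move=> k; have [mF Fk] := Foo k; have [mG Gk] := Goo k; split.
  rewrite -[X in measurable X]setTI; apply: measurable_tailv => //.
  exact: measurableX.
rewrite /lebesgue_step /pushforward -comp_preimage.
rewrite (_ : _ \o _ = id) ?preimage_id; last first.
  by apply/funext => p; exact: consvK.
by rewrite product_measure1E// lte_mul_pinfty// ge0_fin_numE.
Qed.

HB.instance Definition _ := Measure_isSigmaFinite.Build _ _ _ lebesgue_step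
  lebesgue_step_sigma_finite.
End step.

Fixpoint lebesgue_rV n : {sigma_finite_measure set (borel 'rV[R]_n) -> \bar R} :=
  if n is n'.+1 then lebesgue_step (lebesgue_rV n')
  else \d_(0%R : borel 'rV[R]_0).

Lemma lebesgue_rV_box n (A : 'I_n -> set R) : (forall i, measurable (A i)) ->
  lebesgue_rV n [set x | forall i, A i (x ord0 i)] =
  \prod_(i < n) lebesgue_measure (A i).
Proof.
elim: n A => [|n IH] A mA.
  rewrite big_ord0 /= diracE mem_set//.
  by move=> [].
pose B : set (borel 'rV[R]_n) :=
  [set x : 'rV[R]_n | forall i : 'I_n, A (lift ord0 i) (x ord0 i)].
have mB : measurable B.
  have -> : B = \bigcap_(i in [set: 'I_n])
        (setT `&` (fun x : 'rV[R]_n => x ord0 i) @^-1` A (lift ord0 i)).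
    apply/seteqP; split => [x Ax i _|x Ax i]; first by split => //; exact: Ax.
    exact: (Ax i I).2.
  apply: fin_bigcap_measurable => // i _.
  by apply: (@measurable_rV_coord _ _ i) => //; exact: mA.
transitivity ((@lebesgue_measure R \x lebesgue_rV n) (A ord0 `*` B)); last first.
  rewrite big_ord_recl -(IH (fun i => A (lift ord0 i)))//.
  exact: (product_measure1E (@lebesgue_measure R) (lebesgue_rV n) (mA ord0) mB).
rewrite /= /lebesgue_step /pushforward.
congr (_ \x _); apply/seteqP; split => [[t v] /= Atv|[t v] /= [At Av] j].
  split; first by have := Atv ord0; rewrite mxE unlift_none.
  by move=> i; have := Atv (lift ord0 i); rewrite mxE liftK.
by case: (unliftP ord0 j) => [i ->|->]; rewrite mxE ?liftK ?unlift_none.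
Qed.

End lebesgue_rV.

Section sphere.
Context {R : realType}.

(* The norm [`|x|] of the library on row vectors is the sup norm. *)
Definition enorm n (x : 'rV[R]_n) : R := Num.sqrt (\sum_i x ord0 i ^+ 2).

Definition unit_sphere n : set 'rV[R]_n := [set x | enorm x = 1].

Lemma measurable_enorm n :
  measurable_fun setT (@enorm n : borel 'rV[R]_n -> R).
Proof.
have mc i := @measurable_rV_coord R n i.
apply: (@measurableT_comp _ _ _ _ _ _ (@Num.sqrt R)).
  by apply: continuous_measurable_fun; exact: sqrt_continuous.
by apply: measurable_sum => i; exact: measurable_funX.
Qed.

Let measurable_enormV n :
  measurable_fun setT (fun x : borel 'rV[R]_n => (enorm (x : 'rV[R]_n))^-1).
Proof.
rewrite (_ : (fun _ => _) = (fun r => r `^ (-1)) \o @enorm n).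
  by apply: measurableT_comp; [exact: measurable_powR|exact: measurable_enorm].
by apply/funext => x /=; rewrite powR_inv1// sqrtr_ge0.
Qed.

Let dir n (x : 'rV[R]_n) : 'rV[R]_n := (enorm x)^-1 *: x.

Let measurable_dir n :
  measurable_fun setT (@dir n : borel 'rV[R]_n -> borel 'rV[R]_n).
Proof.
apply: (@measurable_fun_rV R _ (borel 'rV[R]_n)) => i.
under eq_fun do rewrite mxE.
by apply: measurable_funM; [exact: measurable_enormV|exact: measurable_rV_coord].
Qed.

(* Lebesgue measure is n^-1 times the surface measure on solid sectors of the
   unit ball: sigma A = n * lambda {r z | 0 < r <= 1, z in A}. This is extended
   to R^n by giving mass 0 to the complement of the sphere. *)
Definition surface_measure n (A : set (borel 'rV[R]_n)) : \bar R :=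
  (n%:R%:E * lebesgue_rV n
    [set x : 'rV[R]_n | (0 < enorm x <= 1)%R /\ A ((enorm x)^-1 *: x)%R])%E.

Section is_measure.
Variable n : nat.

Let mball : measurable ([set x : 'rV[R]_n | 0 < enorm x <= 1] : set (borel 'rV[R]_n)).
Proof.
have := @measurable_enorm n measurableT [set` `]0, 1] ] (measurable_itv _).
by rewrite setTI.
Qed.

Let sm : {measure set (borel 'rV[R]_n) -> \bar R} :=
  mscale (NngNum (ler0n R n))
   (measure_function_pushforward__canonical__measure_function_Measure
    (mrestr (lebesgue_rV n) mball) (@measurable_dir n)).

Let surface_measureE : @surface_measure n = sm.
Proof.
apply/funext => A; rewrite /surface_measure /sm /= /mscale/= /pushforward /mrestr.
by congr (_ * lebesgue_rV _ _)%E; rewrite setIC.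
Qed.

Let surface_measure0 : @surface_measure n set0 = 0%E.
Proof. by rewrite surface_measureE measure0. Qed.

Let surface_measure_ge0 A : (0 <= @surface_measure n A)%E.
Proof. by rewrite surface_measureE. Qed.

Let surface_measure_sigma_additive : semi_sigma_additive (@surface_measure n).
Proof. by rewrite surface_measureE; exact: measure_semi_sigma_additive. Qed.

HB.instance Definition _ := isMeasure.Build _ _ _ (@surface_measure n)
  surface_measure0 surface_measure_ge0 surface_measure_sigma_additive.
End is_measure.
End sphere.

Section complex_functions.
Context {R : realType}.

Definition ccontinuous_within (T : topologicalType) (A : set T)
    (f : T -> R[i]) :=
  {within A, continuous (fun x => complex.Re (f x))} /\
  {within A, continuous (fun x => complex.Im (f x))}.

Section measure.
Context d (T : measurableType d) (mu : {measure set T -> \bar R}).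
Implicit Types f : T -> R[i].

(* For a measure on [borel (subspace Omega)] (see below), measurability on
   [setT] constrains a function only on Omega. *)
Definition cmeasurable f :=
  measurable_fun setT (fun x => complex.Re (f x)) /\
  measurable_fun setT (fun x => complex.Im (f x)).

Definition cintegral f : R[i] :=
  (\int[mu]_x complex.Re (f x)) +i* (\int[mu]_x complex.Im (f x)).

Definition L2norm f : \bar R :=
  Lnorm mu 2%:E (fun x => (Normc.normc (f x))%:E).

Definition L2 f := cmeasurable f /\ (L2norm f < +oo)%E.

End measure.

(* Operators on L2 classes are represented by their action on functions. *)
Definition unitary d1 (T1 : measurableType d1) d2 (T2 : measurableType d2)
    (mu : {measure set T1 -> \bar R}) (nu : {measure set T2 -> \bar R})
    (U : (T1 -> R[i]) -> (T2 -> R[i])) :=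
  [/\ forall f, L2 mu f -> L2 nu (U f) /\ L2norm nu (U f) = L2norm mu f,
      forall f g, L2 mu f -> L2 mu g -> {ae mu, forall x, f x = g x} ->
        {ae nu, forall y, U f y = U g y},
      forall (c : R[i]) f g, L2 mu f -> L2 mu g ->
        {ae nu, forall y, U (fun x => c * f x + g x) y = c * U f y + U g y} &
      forall g, L2 nu g -> exists2 f, L2 mu f & {ae nu, forall y, U f y = g y}].

End complex_functions.

Section cones.
Context {R : realType} {d : nat}.
Implicit Types (Omega : set 'rV[R]_d) (f : 'rV[R]_d -> R[i]).

Definition convex_cone Omega :=
  @convex_set R 'rV[R]_d Omega /\
  forall (lambda : R) x, 0 < lambda -> Omega x -> Omega (lambda *: x).

Definition iter_partial (s : seq 'I_d) (g : 'rV[R]_d -> R) :=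
  foldr (fun i h => 'D_(delta_mx ord0 i) h) g s.

Definition rschwartz (g : 'rV[R]_d -> R) :=
  forall s : seq 'I_d,
    (forall x, differentiable (iter_partial s g) x) /\
    forall k : nat, exists M : R,
      forall x, (1 + enorm x) ^+ k * `|iter_partial s g x| <= M.

Definition schwartz f :=
  rschwartz (fun x => complex.Re (f x)) /\ rschwartz (fun x => complex.Im (f x)).

(* Restrictions to Omega of Schwartz functions on the ambient space. *)
Definition schwartz_on Omega f :=
  exists2 g, schwartz g & forall x, Omega x -> f x = g x.

Definition angular_density (Q : 'rV[R]_d -> R) :=
  [/\ forall zeta, unit_sphere zeta -> 0 <= Q zeta,
      (@surface_measure R d).-integrable (@unit_sphere R d)
        (fun zeta => (Q zeta)%:E) &
      ~ {ae @surface_measure R d, forall zeta, unit_sphere zeta -> Q zeta = 0}].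

(* A Borel measure on Omega is a measure on [borel (subspace Omega)]: in the
   topology of [subspace Omega] every set of points outside Omega is open, so
   that the sigma-algebra induced on Omega is its Borel sigma-algebra (Omega
   itself need not be a Borel subset of the ambient space), and the complement
   of Omega carries no information. The measures considered give it mass 0. *)
Definition abs_continuous Omega
    (mu : {measure set (borel (subspace Omega)) -> \bar R}) :=
  forall N : set (borel 'rV[R]_d), measurable N ->
    lebesgue_rV d N = 0%E -> mu (N `&` Omega) = 0%E.

(* Intersecting with Omega encodes [mu (~` Omega) = 0]. *)
Definition polar_decomposition Omega
    (mu : {measure set (borel (subspace Omega)) -> \bar R})
    (a : R) (Q : 'rV[R]_d -> R) :=
  forall A : set (borel (subspace Omega)), measurable A ->
    mu A = (\int[@surface_measure R d]_(zeta in @unit_sphere R d)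
             ((Q zeta)%:E *
              \int[lebesgue_measure]_(r in `]0%R, +oo[)
                (r `^ (2 * a - 1) * \1_(A `&` Omega) (r *: zeta)%R)%:E))%E.

Section transform.
Variables (Omega Omegah : set 'rV[R]_d).
Variables (mu : {measure set (borel (subspace Omega)) -> \bar R}).
Variables (muh : {measure set (borel (subspace Omegah)) -> \bar R}).
Variable (K : 'rV[R]_d -> 'rV[R]_d -> R[i]).

Definition L1_weight (D : set 'rV[R]_d)
    (nu : {measure set (borel (subspace D)) -> \bar R}) (rho : R) f :=
  @cmeasurable R _ (borel (subspace D)) f /\
  (\int[nu]_x (Normc.normc (f x) * (1 + enorm x) `^ rho)%:E < +oo)%E.

Definition transform f (xi : 'rV[R]_d) : R[i] :=
  cintegral mu (fun x => f x * K x xi).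

(* Only the values of K on Omega `*` Omegah are meaningful. *)
Definition polynomially_bounded (m mh : R) :=
  exists c : R, forall x xi, Omega x -> Omegah xi ->
    Normc.normc (K x xi) <= c * (1 + enorm x) `^ m * (1 + enorm xi) `^ mh.

Definition homogeneous_kernel :=
  forall (lambda : R) x xi, 0 < lambda -> Omega x -> Omegah xi ->
    K (lambda *: x) xi = K x (lambda *: xi).

Definition inversion_formula (m mh : R) :=
  forall f, L1_weight mu m f -> L1_weight muh mh (transform f) ->
  exists g : 'rV[R]_d -> R[i],
    [/\ {ae mu, forall x, f x = g x},
        ccontinuous_within Omega g,
        exists M : R, forall x, Omega x ->
          Normc.normc (g x) / (1 + enorm x) `^ m <= M &
        forall x, Omega x ->
          g x = cintegral muh (fun xi => transform f xi * conjc (K x xi))].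

Definition unitary_extension (U : ('rV[R]_d -> R[i]) -> 'rV[R]_d -> R[i]) :=
  @unitary R _ (borel (subspace Omega)) _ (borel (subspace Omegah)) mu muh U /\
  forall f, schwartz_on Omega f ->
    {ae muh, forall xi, U f xi = transform f xi}.

(* The last clause is the uniqueness of the unitary extension. *)
Definition plancherel (TL2 : ('rV[R]_d -> R[i]) -> 'rV[R]_d -> R[i]) :=
  [/\ forall f, schwartz_on Omega f -> L2norm muh (transform f) = L2norm mu f,
      unitary_extension TL2 &
      forall U, unitary_extension U -> forall f, L2 mu f ->
        {ae muh, forall xi, U f xi = TL2 f xi}].

End transform.
End cones.

(* Main.v *)
Require Import Defs.
From HB Require Import structures.
From mathcomp Require Import all_boot all_order all_algebra.
From mathcomp Require Import all_classical all_reals all_analysis.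
From mathcomp Require Import complex measurable_realfun lra ring.

Set Implicit Arguments.
Unset Strict Implicit.
Unset Printing Implicit Defensive.

Import Order.TTheory GRing.Theory Num.Theory.
Import numFieldNormedType.Exports.

Local Open Scope classical_set_scope.
Local Open Scope ring_scope.
Local Open Scope complex_scope.

(* Let f be in L2 and split f = f1 + f2 at |x| = t eta. On |x| <= t eta and
   |xi| <= eta / t the kernel is bounded independently of t, because homogeneity
   gives K(x, xi) = K(x / t, t xi); and the product of the masses of these two
   balls is O(eta^(4a)), again independently of t, as both measures have the same
   homogeneity degree 2a. So for eta small the truncation of T between the two
   balls is a Hilbert-Schmidt operator of norm at most 1/2, whence
     |f|^2 <= C (t^(-2s) ||x|^s f|^2 + t^(2 beta) ||xi|^beta T f|^2)
   for every t > 0, and it remains to choose t.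
   On f1 the extended operator must be the integral operator, which is known only
   for Schwartz functions. Let P(u) be the property that both agree almost
   everywhere on u; P is linear, and by Fatou's lemma it is closed under dominated
   pointwise limits. Products of logistic functions and of the weight
   prod_i sigma'(x_i) are Schwartz; rescaling the former yields indicator
   functions of orthants, Dynkin's theorem those of all Borel sets, and simple
   functions all u in L2 with u (1 + |x|)^m in L1. *)

(** * Schwartz functions built from the logistic function *)

Section sigmoid.
Context {R : realType}.

Definition sigmoid (t : R) : R := (1 + expR (- t))^-1.

Lemma sigmoid_gt0 t : 0 < sigmoid t.
Proof. by rewrite invr_gt0 addr_gt0// expR_gt0. Qed.

Lemma sigmoid_lt1 t : sigmoid t < 1.
Proof. by rewrite invf_lt1 ?ltrDl ?addr_gt0 ?expR_gt0. Qed.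

(** The derivative is again a polynomial in [sigmoid]; this closes the algebra [sigmoid_poly] under
    partial derivatives. *)
Lemma is_derive_sigmoid (t : R) :
  is_derive t 1 sigmoid (sigmoid t * (1 - sigmoid t)).
Proof.
have h0 : 1 + expR (- t) != 0 :> R by rewrite gt_eqF// addr_gt0// expR_gt0.
pose f y : R := 1 + expR (- y).
have df : is_derive t 1 f (- expR (- t)).
  have -> : f = (cst 1 + expR \o -%R)%R by apply/funext.
  by apply: is_derive_eq; rewrite add0r mulrN1.
apply: (@is_derive_eq _ _ _ _ _ _ _ _ (@is_deriveV R f t _ 1 h0 df)).
rewrite /sigmoid /f /GRing.scale/=; field.
exact: h0.
Qed.

Lemma sigmoid_ge t : 0 <= t -> 1 - sigmoid t <= expR (- t).
Proof.
move=> t0; have e0 := expR_gt0 (- t).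
have -> : 1 - sigmoid t = expR (- t) * sigmoid t.
  by rewrite /sigmoid; field; rewrite gt_eqF// addr_gt0.
by rewrite ler_piMr ?ltW ?sigmoid_lt1.
Qed.

Lemma sigmoidN t : sigmoid (- t) = 1 - sigmoid t.
Proof.
rewrite /sigmoid opprK expRN; field.
by rewrite !gt_eqF ?addr_gt0 ?expR_gt0.
Qed.

(** The derivative of the logistic function: even, strictly positive and exponentially small at
    infinity. *)
Definition sigmoid_bump (t : R) : R := sigmoid t * (1 - sigmoid t).

Lemma sigmoid_bump_gt0 t : 0 < sigmoid_bump t.
Proof. by rewrite mulr_gt0 ?sigmoid_gt0// subr_gt0 sigmoid_lt1. Qed.

Lemma sigmoid_bump_le t : sigmoid_bump t <= expR (- `|t|).
Proof.
wlog t0 : t / 0 <= t => [H|].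
  have [/H//|/ltW t0] := leP 0 t.
  by rewrite -normrN -[t]opprK /sigmoid_bump sigmoidN mulrC opprB addrC subrK opprK
     normrN -normrN (le_trans _ (H _ _)) ?oppr_ge0// /sigmoid_bump.
rewrite ger0_norm// (le_trans _ (sigmoid_ge t0))//.
by rewrite ler_piMl ?subr_ge0 ?ltW ?sigmoid_lt1.
Qed.

Lemma sigmoid_bump_decay (k : nat) :
  exists M : R, forall t, (1 + `|t|) ^+ k * sigmoid_bump t <= M.
Proof.
(* For u = 1 + |t| the exponential series gives u^(k+1) <= (k+1)! exp(u) = (k+1)! e exp(|t|), and
   u^k <= u^(k+1) because u >= 1. *)
exists (k.+1`!%:R * expR 1 + 1) => t.
have u1 : 1 <= 1 + `|t| by rewrite lerDl.
have u0 := le_trans ler01 u1.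
apply: (@le_trans _ _ ((1 + `|t|) ^+ k * expR (- `|t|))).
  by rewrite ler_wpM2l ?exprn_ge0// sigmoid_bump_le.
apply: (@le_trans _ _ (k.+1`!%:R * expR 1)); last by rewrite lerDl.
rewrite expRN ler_pdivrMr ?expR_gt0// -mulrA -expRD.
have := @expR_ge1Dxn R (1 + `|t|) k u0.
have f0 : 0 < k.+1`!%:R :> R by rewrite ltr0n fact_gt0.
move=> h; apply: (@le_trans _ _ ((1 + `|t|) ^+ k.+1)).
  by rewrite exprS ler_peMl// exprn_ge0.
by rewrite -ler_pdivrMl// mulrC (le_trans _ h)// lerDr.
Qed.

End sigmoid.

(** * An algebra of bounded smooth functions and a Schwartz weight *)

Section sigmoid_polynomials.
Context {R : realType} {n : nat}.
Implicit Types (f g p q Phi : 'rV[R]_n -> R).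

(** An algebra of bounded functions stable under partial derivatives. The slope [k] and the shift
    [b] are free so that the generators can be sharpened into steps at any place. *)
Inductive sigmoid_poly : ('rV[R]_n -> R) -> Prop :=
| sp_cst c : sigmoid_poly (fun _ => c)
| sp_sigmoid i k b : sigmoid_poly (fun x => sigmoid (k * x ord0 i + b))
| sp_add f g : sigmoid_poly f -> sigmoid_poly g -> sigmoid_poly (fun x => f x + g x)
| sp_mul f g : sigmoid_poly f -> sigmoid_poly g -> sigmoid_poly (fun x => f x * g x).

Lemma sp_bounded p : sigmoid_poly p -> exists M, forall x, `|p x| <= M.
Proof.
elim=> [c|i k b|f g _ [M fM] _ [N gN]|f g _ [M fM] _ [N gN]].
- by exists `|c|.
- by exists 1 => x; rewrite ger0_norm ltW// ?sigmoid_lt1// sigmoid_gt0.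
- by exists (M + N) => x; rewrite (le_trans (ler_normD _ _))// lerD.
- by exists (M * N) => x; rewrite normrM ler_pM.
Qed.

Lemma is_diff_ridge (h h' : R -> R) (i : 'I_n) (k b : R) (x v : 'rV[R]_n) :
  (forall t : R, is_derive t 1 h (h' t)) ->
  differentiable (fun y : 'rV[R]_n => h (k * y ord0 i + b)) x /\
  'D_v (fun y : 'rV[R]_n => h (k * y ord0 i + b)) x =
    k * v ord0 i * h' (k * x ord0 i + b).
Proof.
move=> dh.
pose c (y : 'rV[R]_n) : R := y ord0 i.
have dc : differentiable c x by exact: differentiable_coord.
have Dc : 'D_v c x = v ord0 i.
  (* The coordinate map is packed as a linear map, since a continuous linear map is its own
     differential. *)
  have lc : linear c by move=> a u w; rewrite /c !mxE.
  pose cL := GRing.isLinear.Build R 'rV[R]_n R *:%R c lc.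
  pose cl : {linear 'rV[R]_n -> R} := HB.pack c cL.
  rewrite deriveE//.
  by rewrite (@diff_lin _ _ _ cl x (@coord_continuous R 1 n ord0 i)).
pose L (y : 'rV[R]_n) : R := k * c y + b.
have LE : L = k *: c + cst b by apply/funext.
have dL : differentiable L x by rewrite LE; apply: differentiableD => //; exact: differentiableZ.
have DL : 'D_v L x = k * v ord0 i.
  rewrite LE deriveD ?derive_cst ?addr0//; last first.
    exact/derivableZ/diff_derivable.
  by rewrite deriveZ ?Dc//; exact: diff_derivable.
have dhL : differentiable h (L x) by apply/derivable1_diffP; exact: (@ex_derive _ _ _ _ _ _ _ (dh (L x))).
have dcomp : differentiable (h \o L) x by exact: differentiable_comp.
split; first exact: dcomp.
transitivity ('D_v (h \o L) x); first by [].
rewrite (deriveE v dcomp) (diff_comp dL dhL).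
transitivity ('d h (L x) ('d L x v)); first by [].
rewrite (diff1E dhL) -(deriveE v dL) DL derive1E.
by rewrite (@derive_val _ _ _ _ _ _ _ (dh (L x))).
Qed.

Lemma sp_differentiable p x : sigmoid_poly p -> differentiable p x.
Proof.
elim=> [c|i k b|f g _ fd _ gd|f g _ fd _ gd].
- exact: differentiable_cst.
- by have [] := @is_diff_ridge _ _ i k b x 0 is_derive_sigmoid.
- exact: differentiableD.
- exact: differentiableM.
Qed.

Lemma sp_derive p i : sigmoid_poly p ->
  sigmoid_poly (fun x => 'D_(delta_mx ord0 i) p x).
Proof.
elim=> [c|j k b|f g pf Df pg Dg|f g pf Df pg Dg].
- under eq_fun do rewrite derive_cst; exact: sp_cst.
- under eq_fun.
    move=> x; rewrite (@is_diff_ridge _ _ j k b x (delta_mx ord0 i)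
      is_derive_sigmoid).2 -mulrN1 mulrC; over.
  rewrite /=; apply: sp_mul; last exact: sp_cst.
  apply: sp_mul; first exact: sp_sigmoid.
  apply: sp_add; first exact: sp_cst.
  by apply: sp_mul; [exact: sp_sigmoid|exact: sp_cst].
- under eq_fun.
    move=> x; rewrite deriveD; [|exact/diff_derivable/sp_differentiable..]; over.
  exact: sp_add.
- under eq_fun.
    move=> x; rewrite deriveM; [|exact/diff_derivable/sp_differentiable..].
    rewrite /GRing.scale/=; over.
  by apply: sp_add; apply: sp_mul.
Qed.

(** The logarithmic derivatives lie in the algebra; writing this without division makes it stable
    under products even where [Phi] vanishes. *)
Definition sp_logderiv Phi :=
  (forall x, differentiable Phi x) /\
  forall i, exists2 q, sigmoid_poly q &
    forall x, 'D_(delta_mx ord0 i) Phi x = q x * Phi x.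

Lemma sp_logderiv_cst c : sp_logderiv (fun _ => c).
Proof.
split=> [x|i]; first exact: differentiable_cst.
by exists (fun _ => 0); [exact: sp_cst|move=> x; rewrite derive_cst mul0r].
Qed.

Lemma sp_logderivM f g : sp_logderiv f -> sp_logderiv g ->
  sp_logderiv (fun x => f x * g x).
Proof.
move=> [df Df] [dg Dg]; split=> [x|i]; first exact: differentiableM.
have [p pp fp] := Df i; have [q qq gq] := Dg i.
exists (fun x => q x + p x); first exact: sp_add.
move=> x; rewrite deriveM; [|exact: diff_derivable..].
by rewrite fp gq /GRing.scale/=; ring.
Qed.

Lemma sp_logderiv_bump j : sp_logderiv (fun x => sigmoid_bump (x ord0 j)).
Proof.
(* For y = sigmoid t, the derivative of y (1 - y) is (1 - 2 y) times y (1 - y), so the logarithmic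
   derivative is affine in y. *)
have db (t : R) : is_derive t 1 sigmoid_bump
    ((1 - 2 * sigmoid t) * sigmoid_bump t).
  have ds := is_derive_sigmoid t.
  rewrite (_ : sigmoid_bump = sigmoid * (cst 1 - sigmoid))%R//.
  apply: is_derive_eq.
  set y := sigmoid t; rewrite -[LHS]/(y * (0 - y * (1 - y)) + (1 - y) * (y * (1 - y))).
  by rewrite -[RHS]/((1 - 2 * y) * (y * (1 - y))); ring.
have E : (fun x : 'rV[R]_n => sigmoid_bump (x ord0 j)) =
    (fun x => sigmoid_bump (1 * x ord0 j + 0)).
  by apply/funext => x; rewrite mul1r addr0.
split=> [x|i].
  by rewrite E; have [] := @is_diff_ridge _ _ j 1 0 x 0 db.
exists (fun x => (delta_mx ord0 i : 'rV[R]_n) ord0 j * (1 + (- 2) * sigmoid (1 * x ord0 j + 0))).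
  apply: sp_mul; first exact: sp_cst.
  apply: sp_add; first exact: sp_cst.
  by apply: sp_mul; [exact: sp_cst|exact: sp_sigmoid].
move=> x; rewrite {1}E (@is_diff_ridge _ _ j 1 0 x (delta_mx ord0 i) db).2.
by rewrite !mul1r !addr0 mulNr; ring.
Qed.

(** All iterated derivatives keep the form q Phi with q in the algebra: if r is the logarithmic
    derivative of [Phi] in some direction, one more derivative replaces q by q r plus the derivative
    of q. As q is bounded, the decay is that of [Phi]. *)
Lemma rschwartz_sigmoid_poly p Phi : sigmoid_poly p -> sp_logderiv Phi ->
  (forall k : nat, exists M, forall x, (1 + enorm x) ^+ k * `|Phi x| <= M) ->
  rschwartz (fun x => p x * Phi x).
Proof.
move=> sp [dPhi DPhi] Phi_decay s.
have [q sq ->] : exists2 q, sigmoid_poly q &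
    iter_partial s (fun x => p x * Phi x) = (fun x => q x * Phi x).
  elim: s => [|i s [q sq IH]]; first by exists p.
  have [r sr Dr] := DPhi i.
  exists (fun x => q x * r x + 'D_(delta_mx ord0 i) q x).
    by apply: sp_add; [exact: sp_mul|exact: sp_derive].
  rewrite /= -/(iter_partial s _) IH; apply/funext => x.
  rewrite deriveM; last 2 first.
    exact/diff_derivable/sp_differentiable.
    exact: diff_derivable.
  by rewrite Dr /GRing.scale/=; ring.
split=> [x|k].
  by apply: differentiableM => //; exact: sp_differentiable.
have [M qM] := sp_bounded sq; have [N kN] := Phi_decay k.
exists (M * N) => x; rewrite normrM mulrCA ler_pM//.
by rewrite mulr_ge0// exprn_ge0// addr_ge0// sqrtr_ge0.
Qed.

(** A Schwartz function with bounded logarithmic derivatives, which a Gaussian does not have. It is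
    strictly positive, so that any function can be divided by it. *)
Definition schwartz_weight (x : 'rV[R]_n) : R := \prod_i sigmoid_bump (x ord0 i).

Lemma schwartz_weight_gt0 x : 0 < schwartz_weight x.
Proof. by apply: prodr_gt0 => i _; exact: sigmoid_bump_gt0. Qed.

Lemma sp_logderiv_weight : sp_logderiv schwartz_weight.
Proof.
rewrite /schwartz_weight; elim: (index_enum _) => [|i r IH].
  by under eq_fun do rewrite big_nil; exact: sp_logderiv_cst.
by under eq_fun do rewrite big_cons; exact/sp_logderivM/IH/sp_logderiv_bump.
Qed.

Lemma enorm_le_sum (x : 'rV[R]_n) : enorm x <= \sum_i `|x ord0 i|.
Proof.
have s0 (r : seq 'I_n) : 0 <= \sum_(i <- r) `|x ord0 i| by exact: sumr_ge0.
rewrite /enorm -[leRHS]ger0_norm// -sqrtr_sqr ler_wsqrtr//.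
elim: (index_enum _) => [|i r IH]; first by rewrite !big_nil expr0n.
rewrite !big_cons sqrrD real_normK ?num_real// -addrA lerD2l (le_trans IH)// lerDr.
by rewrite mulrn_wge0// mulr_ge0.
Qed.

(** Since 1 + |x| <= 1 + sum |x_i| <= prod (1 + |x_i|), the estimate factors into the one-variable
    decay of the bump. *)
Lemma schwartz_weight_decay (k : nat) :
  exists M, forall x, (1 + enorm x) ^+ k * schwartz_weight x <= M.
Proof.
have [M tM] := @sigmoid_bump_decay R k.
exists (\prod_(i < n) M) => x.
have e0 : 0 <= enorm x := sqrtr_ge0 _.
apply: (@le_trans _ _ ((\prod_i (1 + `|x ord0 i|)) ^+ k * schwartz_weight x)).
  have e1 : 0 <= 1 + enorm x by exact: addr_ge0.
  have p0 : 0 <= \prod_i (1 + `|x ord0 i|).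
    by apply: prodr_ge0 => i _; exact: addr_ge0.
  rewrite ler_wpM2r ?(ltW (schwartz_weight_gt0 x))// lerXn2r ?nnegrE//.
  apply: (@le_trans _ _ (1 + \sum_i `|x ord0 i|)).
    by rewrite lerD2l enorm_le_sum.
  elim: (index_enum _) => [|i r IH]; first by rewrite !big_nil addr0.
  rewrite !big_cons (le_trans _ (ler_wpM2l _ IH)) ?addr_ge0//.
  rewrite mulrDl mul1r mulrDr mulr1 addrCA addrC addrA lerDl mulr_ge0//.
  exact: sumr_ge0.
rewrite -prodrXl -big_split/=; apply: ler_prod => i _; rewrite tM andbT.
by rewrite mulr_ge0 ?exprn_ge0 ?addr_ge0// ltW// sigmoid_bump_gt0.
Qed.

End sigmoid_polynomials.

(** * Borel measures on a cone *)

Section subspace_borel.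
Context {R : realType} {d : nat}.
Variable Omega : set 'rV[R]_d.
Notation X := (borel (subspace Omega)).

Lemma measurable_subspace_out (A : set X) : A `<=` ~` Omega -> measurable A.
Proof. by move=> AO; apply: sub_sigma_algebra; exact: open_subspace_out. Qed.

Lemma measurable_continuous_subspace (f : 'rV[R]_d -> R) :
  {within Omega, continuous f} -> measurable_fun setT (f : X -> R).
Proof.
move=> cf; apply: (measurability _ (RGenOpens.measurableE R)) => //.
move=> _ [_ [a [b ->]] <-]; rewrite setTI; apply: sub_sigma_algebra.
by apply: open_comp => [x _|]; [exact: cf|exact: interval_open].
Qed.

Lemma measurable_subspace_id :
  measurable_fun setT (idfun : X -> borel 'rV[R]_d).
Proof.
apply: (@measurability _ _ _ (borel 'rV[R]_d) _ _ open) => //.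
move=> _ [U oU <-]; rewrite setTI; apply: sub_sigma_algebra.
apply: (@open_comp (subspace Omega) 'rV[R]_d idfun) => // x _.
by apply: (@continuous_subspaceT _ _ Omega idfun) => y; exact: cvg_id.
Qed.

Lemma measurable_subspace_enorm : measurable_fun setT (@enorm R d : X -> R).
Proof.
exact: (measurableT_comp (@measurable_enorm R d) measurable_subspace_id).
Qed.

(** Returns to Borel sets of the ambient space, where orthants are available as generators. The sets
    having a Borel trace form a sigma-algebra that contains the relatively open sets. *)
Lemma measurable_subspace_trace (E : set X) : measurable E ->
  exists2 B : set (borel 'rV[R]_d), measurable B & E `&` Omega = B `&` Omega.
Proof.
pose H : set (set X) := [set E | exists2 B : set (borel 'rV[R]_d),
  measurable B & E `&` Omega = B `&` Omega].
suff : <<s @open (subspace Omega) >> `<=` H by apply.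
apply: smallest_sub => [|U oU].
  split => [|A [B mB AB]|F mF].
  - by exists set0; rewrite ?set0I.
  - exists (~` B); first exact: measurableC.
    rewrite setTD; apply/seteqP; split=> x [nx Ox]; split=> // Bx; apply: nx.
      by have [] : (A `&` Omega) x by rewrite AB.
    by have [] : (B `&` Omega) x by rewrite -AB.
  - have /choice[B BP] : forall k, exists B : set (borel 'rV[R]_d),
        measurable B /\ F k `&` Omega = B `&` Omega.
      by move=> k; have [B ? ?] := mF k; exists B.
    exists (\bigcup_k B k); first by apply: bigcup_measurable => k _; exact: (BP k).1.
    rewrite !setI_bigcupl; apply: eq_bigcupr => k _; exact: (BP k).2.
have [V oV VU] := (open_subspaceP Omega U).1 oU.
by exists V => //; exact: sub_sigma_algebra.
Qed.

End subspace_borel.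

(** Gives the measurability in x of the kernel at a fixed frequency. *)
Lemma continuous_within_section {R : realType} (S T : topologicalType)
    (A : set S) (B : set T) (f : S * T -> R) (y : T) :
  {within A `*` B, continuous f} -> B y ->
  {within A, continuous (fun x => f (x, y))}.
Proof.
move=> /subspace_continuousP cf By; apply/subspace_continuousP => x Ax.
apply: cvg_comp (cf (x, y) (conj Ax By)) => U.
rewrite !nbhs_simpl /within/= => -[[P Q] /= [nP nQ] PQU].
apply: filterS nP => s Ps As /=; apply: (PQU (s, y)); split => //=.
exact: nbhs_singleton nQ.
Qed.

(** The integral of a nonnegative function is a supremum over the simple functions below it, hence
    monotone without measurability. This matters for the polar formula, whose inner integral is not
    known to be measurable in the angle. *)
Lemma ge0_le_integral_nonmeas {R : realType} d (T : measurableType d)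
    (mu : {measure set T -> \bar R}) (D : set T) (f g : T -> \bar R) :
  (forall x, D x -> 0 <= f x)%E -> (forall x, D x -> f x <= g x)%E ->
  (\int[mu]_(x in D) f x <= \int[mu]_(x in D) g x)%E.
Proof.
move=> f0 fg.
rewrite (integral_mkcond D) [leRHS]integral_mkcond.
have f0' x : (0 <= (f \_ D) x)%E by rewrite /patch; case: ifPn => // /set_mem/f0.
have fg' x : ((f \_ D) x <= (g \_ D) x)%E.
  by rewrite /patch; case: ifPn => // /set_mem/fg.
rewrite !ge0_integralTE//; last by move=> x; exact: le_trans (fg' x).
apply: le_ereal_sup => _ [h hf <-]; exists h => //= x.
exact: le_trans (hf x) (fg' x).
Qed.

(** For a < 1/2 the integrand is unbounded at 0, so the fundamental theorem of calculus is applied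
    on intervals [c n, r] that exhaust ]0, r], followed by monotone convergence. *)
Lemma integral_powR_le {R : realType} (a r : R) : 0 < a -> 0 <= r ->
  (\int[lebesgue_measure]_(t in `]0%R, r]) (t `^ (2 * a - 1))%:E
    <= (r `^ (2 * a) / (2 * a))%:E)%E.
Proof.
move=> a0; rewrite le_eqVlt => /predU1P[<-|r0].
  rewrite set_itv_ge ?bnd_simp ?ltxx// integral_set0 lee_fin.
  by rewrite divr_ge0 ?powR_ge0// mulr_ge0// ltW.
have a20 : 0 < 2 * a by rewrite mulr_gt0.
have dp (x : R) : 0 < x ->
    is_derive x 1 ((2 * a)^-1 *: (@powR R ^~ (2 * a))) (x `^ (2 * a - 1)).
  move=> x0; have := is_derive1_powR (2 * a) x0 => dx.
  by apply: is_derive_eq; rewrite /GRing.scale/= mulrA mulVf ?gt_eqF// mul1r.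
have cp b (x : R) : 0 < x -> {for x, continuous (fun t => t `^ b)}.
  move=> x0; have dx := is_derive1_powR b x0.
  have : derivable (@powR R ^~ b) x 1 by exact: (@ex_derive _ _ _ _ _ _ _ dx).
  by move=> /derivable1_diffP /differentiable_continuous.
(* The shift by 2 makes [c n] strictly less than [r] already for n = 0. *)
pose c n : R := r / n.+2%:R.
have c0 n : 0 < c n by rewrite divr_gt0.
have cr n : c n < r.
  by rewrite ltr_pdivrMr// -[ltLHS]mulr1 ltr_pM2l// ltr1n.
pose F n : set R := [set` `[c n, r]].
have FU : \bigcup_n F n = `]0, r]%classic.
  apply/seteqP; split=> [x [n _]|x]; rewrite /F/= !in_itv/=.
    by move=> /andP[cx ->]; rewrite (lt_le_trans (c0 n)).
  move=> /andP[x0 xr].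
  have [k _ kP] : \forall n \near \oo, (r / x <= n%:R) by exact: nbhs_infty_ger.
  exists k => //=; rewrite in_itv/= xr andbT ler_pdivrMr// -ler_pdivrMl// mulrC.
  by rewrite (le_trans (kP k (leqnn _)))// ler_nat ltnW.
rewrite -FU.
have mF n : measurable (F n) by exact: measurable_itv.
have mp b : measurable_fun setT (EFin \o (@powR R ^~ b)).
  by apply/measurable_EFinP; exact: measurable_powR.
have cvF : (\int[lebesgue_measure]_(t in F n) (t `^ (2 * a - 1))%:E)%E @[n --> \oo] -->
    (\int[lebesgue_measure]_(t in \bigcup_n F n) (t `^ (2 * a - 1))%:E)%E.
  apply: ge0_nondecreasing_set_cvg_integral => //.
  - move=> m n mn; apply/subsetPset; apply: subset_itvr; rewrite bnd_simp.
    by rewrite ler_pM2l// lef_pV2 ?posrE// ler_nat.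
  - by move=> n; apply: measurable_funTS; exact: mp.
  - by move=> n x _; rewrite lee_fin powR_ge0.
rewrite -(cvg_lim _ cvF)//; apply: lime_le; first by apply/cvg_ex; eexists; exact: cvF.
apply: nearW => n.
(* The antiderivative is t^(2a) / (2a); its value at [c n] is nonnegative and is dropped. *)
rewrite (@continuous_FTC2 R _ ((2 * a)^-1 *: (@powR R ^~ (2 * a))))//.
- rewrite lee_fin /GRing.scale/= [leRHS]mulrC gerBl.
  by rewrite mulr_ge0 ?powR_ge0// invr_ge0 ltW.
- apply: continuous_in_subspaceT => x; rewrite inE/= in_itv/= => /andP[cx _].
  by apply: cp; exact: lt_le_trans cx.
- split.
  + move=> x; rewrite in_itv/= => /andP[cx _].
    by have := dp x (lt_trans (c0 n) cx) => dx.
  + apply: cvg_at_right_filter; have dx := dp _ (c0 n).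
    have : derivable ((2 * a)^-1 *: (@powR R ^~ (2 * a))) (c n) 1 by [].
    by move=> /derivable1_diffP /differentiable_continuous.
  + apply: cvg_at_left_filter; have dx := dp _ r0.
    have : derivable ((2 * a)^-1 *: (@powR R ^~ (2 * a))) r 1 by [].
    by move=> /derivable1_diffP /differentiable_continuous.
- move=> x; rewrite in_itv/= => /andP[cx _].
  by rewrite derive1E (@derive_val _ _ _ _ _ _ _ (dp x (lt_trans (c0 n) cx))).
Qed.

(** * Masses of balls from polar coordinates *)

Section polar.
Context {R : realType} {d : nat}.
Variables (Omega : set 'rV[R]_d).
Variables (mu : {measure set (borel (subspace Omega)) -> \bar R}).
Variables (a : R) (Q : 'rV[R]_d -> R).
Hypothesis (a_gt0 : 0 < a) (dens_Q : angular_density Q).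
Hypothesis polar_mu : polar_decomposition mu a Q.

Definition eball (r : R) : set 'rV[R]_d := [set x | enorm x <= r].

Lemma enormZ (r : R) (x : 'rV[R]_d) : 0 <= r -> enorm (r *: x) = r * enorm x.
Proof.
move=> r0; rewrite /enorm.
under eq_bigr do rewrite mxE exprMn.
by rewrite -mulr_sumr sqrtrM ?sqr_ge0// sqrtr_sqr ger0_norm.
Qed.

Lemma polar_measure_setC : mu (~` Omega) = 0%E.
Proof.
rewrite polar_mu; last exact: measurable_subspace_out.
rewrite setICl; under eq_integral.
  move=> z _; under eq_integral do rewrite indic0 mulr0.
  rewrite integral0 mule0; over.
by rewrite integral0.
Qed.

Lemma measurable_eball (r : R) :
  measurable (eball r : set (borel (subspace Omega))).
Proof.
have := @measurable_subspace_enorm R d Omega measurableT [set` `]-oo, r]] (measurable_itv _).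
rewrite setTI; congr measurable; apply/seteqP; split=> x /=; by rewrite in_itv.
Qed.

(** The radial integral contributes at most r^(2a) / (2a) in each direction and the angular one the
    total mass of [Q]. Intersecting with [Omega] can only decrease the result, whence an
    inequality. *)
Lemma polar_measure_eball : exists2 C : R, 0 <= C & forall r, 0 <= r ->
  (mu (eball r) <= (C * r `^ (2 * a))%:E)%E.
Proof.
have [Q0 iQ _] := dens_Q.
pose q := (\int[@surface_measure R d]_(z in @unit_sphere R d) (Q z)%:E)%E.
have q0 : (0 <= q)%E by apply: integral_ge0 => z Sz; rewrite lee_fin Q0.
have mS : measurable (@unit_sphere R d : set (borel 'rV[R]_d)).
  have := @measurable_enorm R d measurableT [set 1] (measurable_set1 _).
  by rewrite setTI.
have qfin : q \is a fin_num by exact: integrable_fin_num.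
exists (fine q / (2 * a)).
  by rewrite divr_ge0 ?fine_ge0// mulr_ge0// ltW.
move=> r r0; rewrite polar_mu; last exact: measurable_eball.
have J0 : 0 <= r `^ (2 * a) / (2 * a) by rewrite divr_ge0 ?powR_ge0// mulr_ge0// ltW.
apply: (@le_trans _ _ (\int[@surface_measure R d]_(z in @unit_sphere R d)
   ((r `^ (2 * a) / (2 * a))%:E * (Q z)%:E)%E)%E).
  apply: ge0_le_integral_nonmeas => z Sz.
    by rewrite mule_ge0 ?lee_fin ?Q0//; apply: integral_ge0 => t _;
       rewrite lee_fin mulr_ge0 ?powR_ge0.
  rewrite muleC; apply: lee_wpmul2r; first by rewrite lee_fin Q0.
  apply: le_trans (integral_powR_le a_gt0 r0).
  rewrite [leLHS]integral_mkcond [leRHS]integral_mkcond.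
  apply: ge0_le_integral_nonmeas => t _.
    by rewrite /patch; case: ifP => // _; rewrite lee_fin mulr_ge0 ?powR_ge0.
  have inE' (b : interval R) : (t \in [set` b]) = (t \in b).
    by apply/idP/idP => [/set_mem|/mem_set].
  rewrite /patch !inE' !in_itv/= andbT.
  case: (ltP 0 t) => //= t0.
  rewrite indicE; case: (boolP (_ \in _)) => [|_]; last first.
    by rewrite mulr0; case: ifP => // _; rewrite lee_fin powR_ge0.
  rewrite inE => -[+ _]; rewrite /eball/=.
  (* On the unit sphere |t z| = t, so the ball cuts the ray at t = r. *)
  have -> : enorm (t *: z)%R = t by rewrite enormZ ?ltW// [enorm z]Sz mulr1.
  by move=> ->; rewrite mulr1.
rewrite ge0_integralZl//.
- have -> : fine q / (2 * a) * r `^ (2 * a) = r `^ (2 * a) / (2 * a) * fine q.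
    by ring.
  by rewrite [leRHS]EFinM fineK.
- by have /integrableP[] := iQ.
Qed.

End polar.

(** * Integrability of decaying weights when balls grow polynomially *)

Section weights.
Context {R : realType} {d : nat}.
Variables (Omega : set 'rV[R]_d).
Variables (mu : {measure set (borel (subspace Omega)) -> \bar R}).
Variables (a C : R).
Hypothesis C_ge0 : 0 <= C.
Hypothesis mu_eball : forall r, 0 <= r ->
  (mu (eball r) <= (C * r `^ (2 * a))%:E)%E.

Lemma enorm_ge0 (x : 'rV[R]_d) : 0 <= enorm x.
Proof. exact: sqrtr_ge0. Qed.

Lemma dyadic_bracket (t : R) : 1 <= t -> exists k, 2 ^+ k <= t < 2 ^+ k.+1.
Proof.
move=> t1; have t0 := le_trans ler01 t1.
have /andP[Nt tN] := truncn_itv t0; set N := Num.truncn t in Nt tN.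
have N0 : (0 < N)%N.
  by rewrite lt0n; apply/eqP => N0; move: tN; rewrite N0 ltNge t1.
have /andP[kN Nk] := trunc_log_bounds (ltnSn 1) N0.
exists (trunc_log 2 N); rewrite -!natrX (le_trans _ Nt) ?ler_nat//=.
by rewrite (lt_le_trans tN)// ler_nat.
Qed.

Lemma measurable_enorm_powV n : measurable_fun setT
    (fun x : borel (subspace Omega) => (((1 + enorm x) ^+ n)^-1)%:E).
Proof.
apply/measurable_EFinP.
rewrite (_ : (fun _ => _) = (fun x => (1 + enorm x) `^ (- n%:R))); last first.
  by apply/funext => x; rewrite powRN powR_mulrn// addr_ge0// enorm_ge0.
apply: (measurableT_comp (measurable_powR _)).
by apply: measurable_funD => //; exact: measurable_subspace_enorm.
Qed.

(** Dyadic decomposition: where 2^k <= 1 + |x| < 2^(k+1) the integrand is at most 2^(-nk), and the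
    ball of radius 2^(k+1) has mass at most C 2^(2a(k+1)). For n >= 2a + 1 these bounds are summable
    like 2^(-k). *)
Lemma integral_enorm_powV : exists n : nat,
  (\int[mu]_x (((1 + enorm x) ^+ n)^-1)%:E < +oo)%E.
Proof.
pose n := (Num.truncn (`|2 * a| + 1)).+1; exists n.
have n_gt : 2 * a + 1 <= n%:R.
  rewrite (@le_trans _ _ (`|2 * a| + 1)) ?lerD2r ?ler_norm//.
  by apply/ltW; have /andP[_] := truncn_itv (addr_ge0 (normr_ge0 (2 * a)) ler01).
pose u k (x : borel (subspace Omega)) : \bar R :=
  ((2 ^- (n * k)) * \1_(eball (2 ^+ k.+1) : set (borel (subspace Omega))) x)%:E.
have u0 k x : (0 <= u k x)%E by rewrite lee_fin mulr_ge0// invr_ge0 exprn_ge0.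
have mu_ k : measurable_fun setT (u k).
  apply/measurable_EFinP; apply: measurable_funM => //.
  by apply: measurable_indic; exact: measurable_eball.
have mw := measurable_enorm_powV n.
apply: (@le_lt_trans _ _ (\int[mu]_x \sum_(k <oo) u k x)%E).
  apply: ge0_le_integral_nonmeas => x _.
    by rewrite lee_fin invr_ge0 exprn_ge0// addr_ge0// enorm_ge0.
  have x1 : 1 <= 1 + enorm x by rewrite lerDl enorm_ge0.
  have [k /andP[kx xk]] := dyadic_bracket x1.
  have x0 := lt_le_trans ltr01 x1.
  (* The single term of index [k] already dominates the integrand at [x]. *)
  apply: le_trans (nneseries_lim_ge k.+1 _); last by move=> *; exact: u0.
  rewrite big_nat_recr//= -[leLHS]add0e; apply: leeD.
    by apply: sume_ge0 => j _; exact: u0.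
  rewrite lee_fin indicE mem_set ?mulr1; last first.
    by apply/ltW; apply: le_lt_trans xk; rewrite lerDr.
  rewrite lef_pV2 ?posrE ?exprn_gt0// mulnC exprM lerXn2r ?nnegrE ?exprn_ge0//.
  exact: ltW.
rewrite integral_nneseries//.
(* Normalised so that the geometric term r / 2^(k+1) equals C 2^(2a) 2^(-k). *)
pose r := 2 * (C * 2 `^ (2 * a)).
have r0 : 0 <= r by rewrite !mulr_ge0 ?powR_ge0.
apply: (@le_lt_trans _ _ (r / 2 ^+ 0)%:E); last by rewrite ltry.
rewrite -(cvg_lim _ (@cvg_geometric_eseries_half R r 0))//.
apply: lee_nneseries => [k _ _|k _]; first by apply: integral_ge0 => x _; exact: u0.
under eq_integral do rewrite /u EFinM.
rewrite ge0_integralZl//; last first.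
  by apply/measurable_EFinP; apply: measurable_indic; exact: measurable_eball.
rewrite integral_indic//; last exact: measurable_eball.
rewrite setIT; apply: (@le_trans _ _ ((2 ^- (n * k))%:E * (C * (2 ^+ k.+1) `^ (2 * a))%:E)%E).
  apply: lee_wpmul2l; first by rewrite lee_fin invr_ge0 exprn_ge0.
  by apply: mu_eball; rewrite exprn_ge0.
rewrite -EFinM lee_fin addn1 natrX.
have -> : r / 2 ^+ k.+1 = C * (2 `^ (2 * a) / 2 ^+ k).
  by rewrite /r exprS invfM; field; rewrite expf_neq0.
rewrite mulrCA ler_wpM2l//.
rewrite -!powR_mulrn// -!powRrM -!powRN -!powRD ?pnatr_eq0 ?implybT//.
rewrite ler_powR ?ler1n// -[k.+1]addn1 natrD natrM.
have k0 : 0 <= k%:R :> R by [].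
have := mulr_ge0 k0 (_ : 0 <= n%:R - (2 * a + 1)); rewrite subr_ge0 => /(_ n_gt).
lra.
Qed.

Lemma integral_schwartz_weight (m : R) :
  (\int[mu]_x (schwartz_weight x * (1 + enorm x) `^ m)%:E < +oo)%E.
Proof.
have [n fn] := integral_enorm_powV.
pose k := (Num.truncn `|m|).+1.
have mk : m <= k%:R.
  apply: (le_trans (ler_norm m)); apply/ltW.
  by have /andP[_] := truncn_itv (normr_ge0 m).
(* Of the k + n powers of decay, k absorb the factor (1 + |x|)^m and n ensure integrability. *)
have [M PM] := @schwartz_weight_decay R d (k + n).
have M0 : 0 <= M.
  apply: le_trans (PM 0); rewrite mulr_ge0 ?(ltW (schwartz_weight_gt0 _))//.
  by rewrite exprn_ge0// addr_ge0// enorm_ge0.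
suff : forall x : 'rV[R]_d,
    schwartz_weight x * (1 + enorm x) `^ m <= M * ((1 + enorm x) ^+ n)^-1.
  move=> H; apply: (@le_lt_trans _ _
      (\int[mu]_x (M%:E * (((1 + enorm x) ^+ n)^-1)%:E))%E).
    apply: ge0_le_integral_nonmeas => x _; last by rewrite -EFinM lee_fin H.
    by rewrite lee_fin mulr_ge0 ?powR_ge0// ltW// schwartz_weight_gt0.
  rewrite ge0_integralZl//.
  - by rewrite lte_mul_pinfty// lee_fin.
  - exact: measurable_enorm_powV.
  - by move=> x _; rewrite lee_fin invr_ge0 exprn_ge0// addr_ge0// enorm_ge0.
move=> x.
have x1 : 1 <= 1 + enorm x by rewrite lerDl enorm_ge0.
have x0 := lt_le_trans ltr01 x1.
rewrite ler_pdivlMr ?exprn_gt0// (le_trans _ (PM x))//.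
rewrite mulrC [leRHS]mulrC mulrCA ler_wpM2l ?(ltW (schwartz_weight_gt0 _))//.
rewrite exprD mulrC ler_wpM2r ?exprn_ge0 ?(ltW x0)//.
by rewrite -powR_mulrn ?(ltW x0)// ler_powR.
Qed.

End weights.

(** * Complex-valued functions *)

Section complex_L2.
Context {R : realType} d (T : measurableType d) (mu : {measure set T -> \bar R}).
Implicit Types (f : T -> R[i]) (z w : R[i]).

Lemma ae_imp (P Q : T -> Prop) : (forall x, P x -> Q x) ->
  {ae mu, forall x, P x} -> {ae mu, forall x, Q x}.
Proof. by move=> PQ; apply: filterS. Qed.

Lemma ae_imp2 (P Q S : T -> Prop) : (forall x, P x -> Q x -> S x) ->
  {ae mu, forall x, P x} -> {ae mu, forall x, Q x} -> {ae mu, forall x, S x}.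
Proof. by move=> PQ; apply: filterS2. Qed.

Lemma normc_sqr z : Normc.normc z ^+ 2 = complex.Re z ^+ 2 + complex.Im z ^+ 2.
Proof. by case: z => a b /=; rewrite sqr_sqrtr// addr_ge0 ?sqr_ge0. Qed.

Lemma normc_ge0 z : 0 <= Normc.normc z.
Proof. by case: z => a b /=; rewrite sqrtr_ge0. Qed.

Lemma L2norm_sqr f :
  (L2norm mu f `^ 2 = \int[mu]_x (Normc.normc (f x) ^+ 2)%:E)%E.
Proof.
rewrite /L2norm poweR_Lnorm ?pnatr_eq0//; apply: eq_integral => x _.
by rewrite gee0_abs ?lee_fin ?normc_ge0// poweR_EFin powR_mulrn ?normc_ge0.
Qed.

Lemma L2norm_ge0 f : (0 <= L2norm mu f)%E.
Proof. exact: Lnorm_ge0. Qed.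

Lemma L2norm_lty f :
  (L2norm mu f < +oo)%E <-> (\int[mu]_x (Normc.normc (f x) ^+ 2)%:E < +oo)%E.
Proof.
rewrite -L2norm_sqr; split => [|]; first exact: poweR_lty.
by apply: lty_poweRy; rewrite pnatr_eq0.
Qed.

Lemma measurable_normc_sqr f : cmeasurable f ->
  measurable_fun setT (fun x => (Normc.normc (f x) ^+ 2)%:E).
Proof.
move=> [mRe mIm]; apply/measurable_EFinP; under eq_fun do rewrite normc_sqr.
by apply: measurable_funD; exact: measurable_funX.
Qed.

Lemma cmeasurableB f g : cmeasurable f -> cmeasurable g ->
  cmeasurable (fun x => f x - g x).
Proof.
move=> [fR fI] [gR gI]; split.
  under eq_fun do rewrite raddfB; exact: measurable_funB.
under eq_fun do rewrite raddfB; exact: measurable_funB.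
Qed.

End complex_L2.

Lemma ae_subspace {R : realType} {d : nat} (Omega : set 'rV[R]_d)
    (mu : {measure set (borel (subspace Omega)) -> \bar R}) (P : 'rV[R]_d -> Prop) :
  mu (~` Omega) = 0%E -> (forall x, Omega x -> P x) -> {ae mu, forall x, P x}.
Proof.
move=> muC OP; exists (~` Omega); split => //; first exact: measurable_subspace_out.
by move=> x /= nP Ox; apply: nP; exact: OP.
Qed.

(** * Limits almost everywhere *)

Section fatou_limit.
Context {R : realType} d (T : measurableType d) (mu : {measure set T -> \bar R}).

Lemma ae_and (P Q : T -> Prop) : {ae mu, forall x, P x} ->
  {ae mu, forall x, Q x} -> {ae mu, forall x, P x /\ Q x}.
Proof. exact: ae_imp2. Qed.

Lemma measurable_limn_einf (h : nat -> T -> \bar R) :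
  (forall n, measurable_fun setT (h n)) ->
  measurable_fun setT (fun x => limn_einf (h ^~ x)).
Proof.
move=> mh; rewrite (_ : (fun _ => _) =
    (fun x => - limn_esup ((fun n => \- h n)%E ^~ x))%E); last first.
  apply/funext => x; rewrite -limn_einfN; congr limn_einf.
  by apply/funext => n /=; rewrite oppeK.
apply: measurableT_comp => //; apply: measurable_fun_limn_esup => n.
exact: measurableT_comp.
Qed.

(* By Fatou, L1 convergence to 0 identifies pointwise limits. *)
Lemma ae_limn_einf0 (h : nat -> T -> \bar R) :
  (forall n, measurable_fun setT (h n)) -> (forall n x, 0 <= h n x)%E ->
  (\int[mu]_x h n x @[n --> \oo] --> 0)%E ->
  {ae mu, forall x, limn_einf (h ^~ x) = 0%E}.
Proof.
move=> mh h0 ch.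
have l0 x : (0 <= limn_einf (h ^~ x))%E.
  rewrite limn_einf_lim; apply: lime_ge; first exact: is_cvg_einfs.
  by apply: nearW => n; apply: le_ereal_inf_tmp => _ [k _ <-].
have i0 : (\int[mu]_x limn_einf (h ^~ x) = 0)%E.
  apply/eqP; rewrite eq_le integral_ge0 ?andbT//.
  apply: le_trans (fatou mu measurableT mh (fun n x _ => h0 n x)) _.
  by rewrite is_cvg_limn_einfE ?(cvg_lim _ ch)//; apply/cvg_ex; exists 0%E.
have := (ae_eq_integral_abs mu measurableT (measurable_limn_einf mh)).1.
rewrite (_ : (\int[mu]_x `|_| = _)%E = (\int[mu]_x limn_einf (h ^~ x) = 0)%E); last first.
  by congr (_ = _); apply: eq_integral => x _; rewrite gee0_abs.
by move=> /(_ i0); apply: ae_imp => x; apply.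
Qed.

End fatou_limit.

Section real_complex.
Context {R : realType}.
Implicit Types (u : R) (z : R[i]).

Lemma cvg_sqr (f : nat -> R) (l : R) : f n @[n --> \oo] --> l ->
  f n ^+ 2 @[n --> \oo] --> l ^+ 2.
Proof.
move=> fl; under eq_fun do rewrite expr2.
by rewrite expr2; exact: cvgM.
Qed.

Lemma Re_rcM u z : complex.Re (u%:C * z) = u * complex.Re z.
Proof. by case: z => a b /=; rewrite mul0r subr0. Qed.

Lemma Im_rcM u z : complex.Im (u%:C * z) = u * complex.Im z.
Proof. by case: z => a b /=; rewrite mul0r addr0. Qed.

Lemma normc_rc_sqr u : Normc.normc u%:C ^+ 2 = u ^+ 2.
Proof. by rewrite normc_sqr/= expr0n addr0. Qed.

Lemma Re_le_normc z : `|complex.Re z| <= Normc.normc z.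
Proof.
rewrite -ler_sqr ?nnegrE ?normc_ge0// normc_sqr real_normK ?num_real//.
by rewrite lerDl sqr_ge0.
Qed.

Lemma Im_le_normc z : `|complex.Im z| <= Normc.normc z.
Proof.
rewrite -ler_sqr ?nnegrE ?normc_ge0// normc_sqr real_normK ?num_real//.
by rewrite lerDr sqr_ge0.
Qed.

Lemma normc_sqrD (z w : R[i]) :
  Normc.normc (z + w) ^+ 2 <= 2 * Normc.normc z ^+ 2 + 2 * Normc.normc w ^+ 2.
Proof.
rewrite !normc_sqr !raddfD /= -subr_ge0.
set a := complex.Re z; set b := complex.Im z; set p := complex.Re w; set q := complex.Im w.
rewrite [leRHS](_ : _ = (a - p) ^+ 2 + (b - q) ^+ 2); last by ring.
by rewrite addr_ge0 ?sqr_ge0.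
Qed.

Lemma normc_sqr_rcM (t : R) (z : R[i]) :
  Normc.normc (t%:C * z) ^+ 2 = t ^+ 2 * Normc.normc z ^+ 2.
Proof. by rewrite Normc.normcM exprMn normc_rc_sqr. Qed.

End real_complex.

Section weighted_functions.
Context {R : realType} {d : nat}.

Lemma cmeasurable_rcM D (t : 'rV[R]_d -> R) (f : 'rV[R]_d -> R[i]) :
  measurable_fun setT (t : borel (subspace D) -> R) ->
  @cmeasurable R _ (borel (subspace D)) f ->
  @cmeasurable R _ (borel (subspace D)) (fun x => (t x)%:C * f x).
Proof.
move=> mt [mR mI]; split.
  by under eq_fun do rewrite Re_rcM; exact: measurable_funM.
by under eq_fun do rewrite Im_rcM; exact: measurable_funM.
Qed.

Lemma cmeasurable_enorm_powR D (s : R) (f : 'rV[R]_d -> R[i]) :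
  @cmeasurable R _ (borel (subspace D)) f ->
  @cmeasurable R _ (borel (subspace D)) (fun x => (enorm x `^ s)%:C * f x).
Proof.
apply: cmeasurable_rcM; apply: (measurableT_comp (measurable_powR s)).
exact: measurable_subspace_enorm.
Qed.

(** Chebyshev's inequality in pointwise form: it bounds the part outside a ball by a weighted
    norm. *)
Lemma powR_weight_ge1 (r s : R) (x : 'rV[R]_d) : 0 < r -> 0 <= s -> ~ eball r x ->
  1 <= (r `^ s) ^- 2 * (enorm x `^ s) ^+ 2.
Proof.
move=> r0 s0 /negP; rewrite -ltNge => rx.
rewrite mulrC ler_pdivlMr ?exprn_gt0 ?powR_gt0// mul1r.
apply: lerXn2r; rewrite ?nnegrE ?powR_ge0//.
by apply: ge0_ler_powR; rewrite ?nnegrE ?(ltW r0) ?enorm_ge0// (ltW rx).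
Qed.

End weighted_functions.

(** * Logistic approximation of orthants *)

Section sigmoid_step.
Context {R : realType}.

(* The shift by k makes the limit at the jump point equal to 1. *)
Lemma cvg_sigmoid_step (t c : R) :
  sigmoid (k%:R ^+ 2 * t + (k%:R - k%:R ^+ 2 * c)) @[k --> \oo] --> ((c <= t)%R%:R : R).
Proof.
have sq2 (k : nat) : (k%:R : R) ^+ 2 * t + (k%:R - k%:R ^+ 2 * c) = k%:R + k%:R ^+ 2 * (t - c).
  by ring.
under eq_fun do rewrite sq2.
have e0 : expR (- k%:R) @[k --> \oo] --> (0 : R) by exact: cvgn_expR.
have [ct|tc] := leP c t.
  apply: (@squeeze_cvgr _ _ _ _ (fun k => 1 - expR (- k%:R)) (fun _ => 1)).
  - apply: nearW => k; rewrite (ltW (sigmoid_lt1 _)) andbT lerBlDl -lerBlDr.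
    have kk : k%:R <= k%:R + k%:R ^+ 2 * (t - c).
      by rewrite lerDl mulr_ge0 ?exprn_ge0// subr_ge0.
    rewrite (le_trans (sigmoid_ge _))//; first exact: le_trans kk.
    by rewrite ler_expR lerN2.
  - by rewrite -[X in _ --> X]subr0; apply: cvgB; [exact: cvg_cst|exact: e0].
  - exact: cvg_cst.
apply: (@squeeze_cvgr _ _ _ _ (fun _ => 0) (fun k => expR (- k%:R))).
(* Once k (c - t) >= 2, the quadratic term outweighs the shift and the argument of the logistic
   function is at most -k. *)
- have [n _ Hn] : \forall n \near \oo, (2 / (c - t) <= n%:R :> R) by exact: nbhs_infty_ger.
  exists n => //= k /Hn kP; rewrite (ltW (sigmoid_gt0 _)) /=.
  have kk : k%:R <= - (k%:R + k%:R ^+ 2 * (t - c)).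
    move: kP; rewrite ler_pdivrMr ?subr_gt0// => kP.
    have : 0 <= k%:R * (k%:R * (c - t) - 2) by rewrite mulr_ge0// subr_ge0.
    lra.
  rewrite -[_ + _]opprK sigmoidN (le_trans (sigmoid_ge _))//; first exact: le_trans kk.
  by rewrite ler_expR lerN2.
- exact: cvg_cst.
- exact: e0.
Qed.

End sigmoid_step.

Section orthants.
Context {R : realType} {d : nat}.
Implicit Types s : seq ('I_d * R).

(** Lists of constraints, possibly repeated or leaving coordinates free, turn intersection into
    concatenation; the empty list gives the whole space. *)
Definition orthant s : set 'rV[R]_d :=
  [set x | forall p, p \in s -> p.2 <= x ord0 p.1].

Definition sigmoid_orthant s (k : nat) (x : 'rV[R]_d) : R :=
  \prod_(p <- s) sigmoid (k%:R ^+ 2 * x ord0 p.1 + (k%:R - k%:R ^+ 2 * p.2)).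

Lemma indic_orthant s x :
  \1_(orthant s) x = \prod_(p <- s) ((p.2 <= x ord0 p.1)%R%:R : R).
Proof.
rewrite indicE; elim: s => [|p s IH].
  by rewrite big_nil mem_set// => p.
rewrite big_cons -IH -natrM mulnb; congr (nat_of_bool _)%:R.
apply/idP/andP => [/set_mem px|[px /set_mem sx]].
  split; first by apply: px; rewrite mem_head.
  by apply/mem_set => q qs; apply: px; rewrite inE qs orbT.
by apply/mem_set => q; rewrite inE => /predU1P[->//|]; exact: sx.
Qed.

Lemma cvg_sigmoid_orthant s x :
  sigmoid_orthant s k x @[k --> \oo] --> (\1_(orthant s) x : R).
Proof.
rewrite indic_orthant /sigmoid_orthant; elim: s => [|p s IH].
  by under eq_fun do rewrite big_nil; rewrite big_nil; exact: cvg_cst.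
under eq_fun do rewrite big_cons; rewrite big_cons.
by apply: cvgM; [exact: cvg_sigmoid_step|exact: IH].
Qed.

Lemma sp_sigmoid_orthant s k : sigmoid_poly (sigmoid_orthant s k).
Proof.
elim: s => [|p s IH].
  rewrite (_ : sigmoid_orthant _ _ = fun _ => 1); first exact: sp_cst.
  by apply/funext => x; rewrite /sigmoid_orthant big_nil.
rewrite (_ : sigmoid_orthant _ _ = fun x =>
    sigmoid (k%:R ^+ 2 * x ord0 p.1 + (k%:R - k%:R ^+ 2 * p.2)) * sigmoid_orthant s k x).
  by apply: sp_mul => //; exact: sp_sigmoid.
by apply/funext => x; rewrite /sigmoid_orthant big_cons.
Qed.

Lemma sigmoid_orthant_ge0 s k x : 0 <= sigmoid_orthant s k x.
Proof. by apply: prodr_ge0 => p _; rewrite ltW// sigmoid_gt0. Qed.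

Lemma sigmoid_orthant_le1 s k x : sigmoid_orthant s k x <= 1.
Proof.
by apply: prodr_ile1 => p _; rewrite !ltW ?sigmoid_gt0 ?sigmoid_lt1.
Qed.

(** One-element lists give the half-spaces x_i >= c, so every coordinate, and with it the identity
    map, is measurable for the sigma-algebra generated by orthants. *)
Lemma measurable_orthants :
  @measurable _ (borel 'rV[R]_d) `<=` <<s range orthant >>.
Proof.
pose TG : measurableType _ := g_sigma_algebraType (range orthant).
have mid : measurable_fun setT ((idfun : 'rV[R]_d -> 'rV[R]_d) : TG -> borel 'rV[R]_d).
  apply: (@measurable_fun_rV R _ TG) => i.
  apply: (measurability _ (RGenCInfty.measurableE R)) => //.
  move=> _ [_ [c ->] <-]; rewrite setTI; apply: sub_sigma_algebra.
  exists [:: (i, c)] => //; apply/seteqP; split => x /=.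
    by rewrite in_itv/= andbT => /(_ (i, c)); apply; rewrite mem_head.
  by rewrite in_itv/= andbT => cx p; rewrite inE => /eqP ->.
by move=> B mB; have := mid measurableT B mB; rewrite setTI.
Qed.

Lemma setI_closed_orthants : setI_closed (range orthant).
Proof.
move=> _ _ [s _ <-] [s' _ <-]; exists (s ++ s') => //.
apply/seteqP; split => [x H|x [H H'] p].
  by split => p ps; apply: H; rewrite mem_cat ps ?orbT.
by rewrite mem_cat => /orP[/H|/H'].
Qed.

End orthants.

(** * The extended operator as an integral operator *)

Section transform.
Context {R : realType} {d : nat}.
Variables (Omega Omegah : set 'rV[R]_d).
Variables (mu : {measure set (borel (subspace Omega)) -> \bar R}).
Variables (muh : {measure set (borel (subspace Omegah)) -> \bar R}).
Variables (K : 'rV[R]_d -> 'rV[R]_d -> R[i]) (m : R).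
Variable (TL2 : ('rV[R]_d -> R[i]) -> ('rV[R]_d -> R[i])).
Notation X := (borel (subspace Omega)).
Notation Xh := (borel (subspace Omegah)).
Notation normsq f x := (Normc.normc (f x) ^+ 2).
Notation Phi := (@schwartz_weight R d).
Hypothesis muC : mu (~` Omega) = 0%E.
Hypothesis muhC : muh (~` Omegah) = 0%E.
Hypothesis K_meas : forall xi, Omegah xi ->
  @cmeasurable R _ X (K^~ xi).
Hypothesis K_bound : forall xi, Omegah xi -> exists c : R, forall x, Omega x ->
  Normc.normc (K x xi) <= c * (1 + enorm x) `^ m.
Hypothesis TL2_unitary : unitary_extension mu muh K TL2.
Hypothesis m_ge0 : 0 <= m.
Hypothesis int_weight :
  (\int[mu]_x (schwartz_weight x * (1 + enorm x) `^ m)%:E < +oo)%E.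

(** Functions on which both operators make sense: square integrability is for the unitary extension,
    the weighted L1 bound for absolute convergence against a kernel growing like (1 + |x|)^m. Real
    values suffice, complex functions being split later. *)
Definition l1l2 (u : 'rV[R]_d -> R) := [/\ measurable_fun setT (u : X -> R),
  (\int[mu]_x ((u x) ^+ 2)%:E < +oo)%E &
  (\int[mu]_x (`|u x| * (1 + enorm x) `^ m)%:E < +oo)%E].

Lemma measurable_weight (u : 'rV[R]_d -> R) : measurable_fun setT (u : X -> R) ->
  measurable_fun setT (fun x : X => (`|u x| * (1 + enorm x) `^ m)%:E).
Proof.
move=> mu_; apply/measurable_EFinP; apply: measurable_funM.
  exact: measurableT_comp.
apply: (measurableT_comp (measurable_powR _)).
by apply: measurable_funD => //; exact: measurable_subspace_enorm.
Qed.

Lemma l1l2_le (u v : 'rV[R]_d -> R) : measurable_fun setT (u : X -> R) ->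
  (forall x, Omega x -> `|u x| <= `|v x|) -> l1l2 v -> l1l2 u.
Proof.
move=> mu_ uv [mv v2 v1]; split => //.
- apply: le_lt_trans v2; apply: ae_ge0_le_integral => //.
  + by move=> x _; rewrite lee_fin sqr_ge0.
  + by apply/measurable_EFinP; exact: measurable_funX.
  + by move=> x _; rewrite lee_fin sqr_ge0.
  + by apply/measurable_EFinP; exact: measurable_funX.
  + apply: (ae_subspace muC) => x Ox _; rewrite lee_fin.
    rewrite -(real_normK (num_real (u x))) -(real_normK (num_real (v x))).
    by apply: lerXn2r; rewrite ?nnegrE// uv.
- apply: le_lt_trans v1; apply: ae_ge0_le_integral => //.
  + by move=> x _; rewrite lee_fin mulr_ge0// powR_ge0.
  + exact: measurable_weight.
  + by move=> x _; rewrite lee_fin mulr_ge0// powR_ge0.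
  + exact: measurable_weight.
  + apply: (ae_subspace muC) => x Ox _; rewrite lee_fin; by rewrite ler_wpM2r ?powR_ge0 ?uv.
Qed.

Lemma l1l2D (u v : 'rV[R]_d -> R) (c : R) : l1l2 u -> l1l2 v ->
  l1l2 (fun x => c * u x + v x).
Proof.
move=> [mu_ u2 u1] [mv v2 v1].
have mcuv : measurable_fun setT (fun x : X => c * u x + v x).
  by apply: measurable_funD => //; exact: measurable_funM.
split => //.
- apply: (@le_lt_trans _ _ (\int[mu]_x ((2 * c ^+ 2)%:E * (u x ^+ 2)%:E
      + 2%:E * (v x ^+ 2)%:E))%E).
    apply: ge0_le_integral_nonmeas => x _; first by rewrite lee_fin sqr_ge0.
    rewrite -!EFinM -EFinD lee_fin -subr_ge0.
    have -> : 2 * c ^+ 2 * u x ^+ 2 + 2 * v x ^+ 2 - (c * u x + v x) ^+ 2 =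
      (c * u x - v x) ^+ 2 by ring.
    exact: sqr_ge0.
  have mu2 : measurable_fun setT (fun x : X => (u x ^+ 2)%:E).
    by apply/measurable_EFinP; exact: measurable_funX.
  have mv2 : measurable_fun setT (fun x : X => (v x ^+ 2)%:E).
    by apply/measurable_EFinP; exact: measurable_funX.
  have c2 : 0 <= 2 * c ^+ 2 by rewrite mulr_ge0 ?sqr_ge0.
  rewrite ge0_integralD//; first last.
  + exact: measurable_funeM.
  + by move=> x _; rewrite -EFinM lee_fin mulr_ge0 ?sqr_ge0.
  + exact: measurable_funeM.
  + by move=> x _; rewrite -EFinM lee_fin mulr_ge0 ?sqr_ge0.
  rewrite !ge0_integralZl//; do ?by move=> x _; rewrite lee_fin sqr_ge0.
  by rewrite lte_add_pinfty// lte_mul_pinfty// lee_fin.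
- apply: (@le_lt_trans _ _ (\int[mu]_x (`|c|%:E * (`|u x| * (1 + enorm x) `^ m)%:E
      + (`|v x| * (1 + enorm x) `^ m)%:E))%E).
    apply: ge0_le_integral_nonmeas => x _; first by rewrite lee_fin mulr_ge0 ?powR_ge0.
    rewrite -!EFinM -EFinD lee_fin mulrA -mulrDl ler_wpM2r ?powR_ge0//.
    by rewrite -normrM ler_normD.
  rewrite ge0_integralD//; first last.
  + exact: measurable_weight.
  + by move=> x _; rewrite lee_fin mulr_ge0 ?powR_ge0.
  + by apply: measurable_funeM; exact: measurable_weight.
  + by move=> x _; rewrite -EFinM lee_fin !mulr_ge0 ?powR_ge0.
  rewrite ge0_integralZl//.
  + by rewrite lte_add_pinfty// lte_mul_pinfty// lee_fin.
  + exact: measurable_weight.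
  + by move=> x _; rewrite lee_fin mulr_ge0 ?powR_ge0.
Qed.

Lemma integrable_kernel (u k : 'rV[R]_d -> R) (c : R) : l1l2 u ->
  measurable_fun setT (k : X -> R) ->
  (forall x, Omega x -> `|k x| <= c * (1 + enorm x) `^ m) ->
  mu.-integrable setT (EFin \o (fun x => u x * k x)).
Proof.
move=> [mu_ u2 u1] mk kb; apply/integrableP; split.
  by apply/measurable_EFinP; exact: measurable_funM.
apply: (@le_lt_trans _ _ (\int[mu]_x (`|c|%:E * (`|u x| * (1 + enorm x) `^ m)%:E))%E).
  apply: ae_ge0_le_integral => //.
  + by apply/measurable_EFinP; apply: measurableT_comp => //; exact: measurable_funM.
  + by move=> x _; rewrite -EFinM lee_fin !mulr_ge0 ?powR_ge0.
  + by apply: measurable_funeM; exact: measurable_weight.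
  + apply: (ae_subspace muC) => x Ox _.
    rewrite -EFinM lee_fin normrM mulrCA ler_wpM2l// (le_trans (kb x Ox))//.
    by rewrite ler_wpM2r ?powR_ge0 ?ler_norm.
rewrite ge0_integralZl//.
+ by rewrite lte_mul_pinfty// lee_fin.
+ exact: measurable_weight.
+ by move=> x _; rewrite lee_fin mulr_ge0 ?powR_ge0.
Qed.

(** Dominated convergence with majorant |G k|; it is applied to the real and imaginary parts of the
    kernel separately. *)
Lemma cvg_kernel (u_ : nat -> 'rV[R]_d -> R) (u G k : 'rV[R]_d -> R) (c : R) :
  (forall n, measurable_fun setT (u_ n : X -> R)) ->
  measurable_fun setT (u : X -> R) -> l1l2 G ->
  (forall n x, Omega x -> `|u_ n x| <= G x) ->
  (forall x, Omega x -> u_ n x @[n --> \oo] --> u x) ->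
  measurable_fun setT (k : X -> R) ->
  (forall x, Omega x -> `|k x| <= c * (1 + enorm x) `^ m) ->
  (\int[mu]_x (u_ n x * k x)) @[n --> \oo] --> \int[mu]_x (u x * k x).
Proof.
move=> mu_ mu0 lG uG cu mk kb.
have iG := integrable_kernel lG mk kb.
have iGn := integrable_abse iG.
have mf n : measurable_fun setT (fun x : X => (u_ n x * k x)%:E).
  by apply/measurable_EFinP; exact: measurable_funM.
have mf0 : measurable_fun setT (fun x : X => (u x * k x)%:E).
  by apply/measurable_EFinP; exact: measurable_funM.
have cf : {ae mu, forall x, [set: X] x ->
    (u_ n x * k x)%:E @[n --> \oo] --> (u x * k x)%:E}.
  apply: (ae_subspace muC) => x Ox _; apply: cvg_EFin; first exact: nearW.
  by apply: cvgMl; exact: cu.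
have df : {ae mu, forall x, forall n, [set: X] x ->
    (`|(u_ n x * k x)%:E| <= `|(G x * k x)%:E|)%E}.
  apply: (ae_subspace muC) => x Ox n _; rewrite lee_fin !normrM ler_wpM2r//.
  by rewrite (le_trans (uG n x Ox))// ler_norm.
have [iu _ cI] := dominated_convergence measurableT mf mf0 cf iGn df.
rewrite /Rintegral; apply: fine_cvg; rewrite fineK; last exact: integrable_fin_num.
exact: cI.
Qed.

Definition rc (u : 'rV[R]_d -> R) : 'rV[R]_d -> R[i] := fun x => (u x)%:C.

Lemma transform_rcE u xi : transform mu K (rc u) xi =
  (\int[mu]_x (u x * complex.Re (K x xi))) +i*
  (\int[mu]_x (u x * complex.Im (K x xi))).
Proof.
rewrite /transform /cintegral; congr (_ +i* _); apply: eq_Rintegral => x _.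
  by rewrite Re_rcM.
by rewrite Im_rcM.
Qed.

Lemma L2_rc u : l1l2 u -> L2 mu (rc u).
Proof.
move=> [mu_ u2 _]; split; first by split => //; exact: measurable_cst.
apply/L2norm_lty; move: u2; congr (_ < _)%E; apply: eq_integral => x _.
by rewrite normc_rc_sqr.
Qed.

(** The property P(u), extended step by step from Schwartz functions to all of [l1l2]. *)
Definition transform_agrees u :=
  {ae muh, forall xi, TL2 (rc u) xi = transform mu K (rc u) xi}.

Let K_Re xi : Omegah xi -> measurable_fun setT (fun x : X => complex.Re (K x xi)) /\
  exists c : R, forall x, Omega x -> `|complex.Re (K x xi)| <= c * (1 + enorm x) `^ m.
Proof.
move=> Oxi; split; first exact: (K_meas Oxi).1.
have [c cK] := K_bound Oxi; exists c => x Ox.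
exact: le_trans (Re_le_normc _) (cK x Ox).
Qed.

Let K_Im xi : Omegah xi -> measurable_fun setT (fun x : X => complex.Im (K x xi)) /\
  exists c : R, forall x, Omega x -> `|complex.Im (K x xi)| <= c * (1 + enorm x) `^ m.
Proof.
move=> Oxi; split; first exact: (K_meas Oxi).2.
have [c cK] := K_bound Oxi; exists c => x Ox.
exact: le_trans (Im_le_normc _) (cK x Ox).
Qed.

Lemma transform_linear u v (c : R) xi : Omegah xi -> l1l2 u -> l1l2 v ->
  transform mu K (rc (fun x => c * u x + v x)) xi =
  c%:C * transform mu K (rc u) xi + transform mu K (rc v) xi.
Proof.
move=> Oxi lu lv; rewrite !transform_rcE.
have H k c0 : measurable_fun setT (k : X -> R) ->
    (forall x, Omega x -> `|k x| <= c0 * (1 + enorm x) `^ m) ->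
    \int[mu]_x ((c * u x + v x) * k x) =
    c * \int[mu]_x (u x * k x) + \int[mu]_x (v x * k x).
  move=> mk kb; have iu := integrable_kernel lu mk kb.
  have iv := integrable_kernel lv mk kb.
  under eq_Rintegral do rewrite mulrDl -mulrA.
  rewrite RintegralD//; last first.
    by have := integrableZl measurableT c iu.
  by rewrite RintegralZl.
have [mR [cR bR]] := K_Re Oxi; have [mI [cI bI]] := K_Im Oxi.
rewrite (H _ _ mR bR) (H _ _ mI bI) /=.
by congr (_ +i* _); rewrite /= mul0r ?subr0 ?addr0.
Qed.

Lemma transform_agreesD u v (c : R) : l1l2 u -> l1l2 v ->
  transform_agrees u -> transform_agrees v ->
  transform_agrees (fun x => c * u x + v x).
Proof.
move=> lu lv Pu Pv.
have [[_ _ TD _] _] := TL2_unitary.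
have rcD : rc (fun x => c * u x + v x) = (fun x => c%:C * rc u x + rc v x).
  by apply/funext => x; rewrite /rc rmorphD rmorphM.
have T1 := TD c%:C _ _ (L2_rc lu) (L2_rc lv).
have T2 := ae_subspace muhC (fun xi Oxi => transform_linear c Oxi lu lv).
have T3 := ae_and Pu Pv.
have T4 := ae_and T1 T2.
apply: ae_imp2 T3 T4 => xi -[E1 E2] [E3 E4].
by rewrite E4 -E1 -E2 -E3 rcD.
Qed.

(** The images under the extension converge in L2 by isometry, while the integral transforms
    converge pointwise by dominated convergence. [ae_limn_einf0] matches the two limits almost
    everywhere without passing to a subsequence. *)
Lemma transform_agrees_lim (u_ : nat -> 'rV[R]_d -> R) (u G : 'rV[R]_d -> R) :
  (forall n, measurable_fun setT (u_ n : X -> R)) ->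
  measurable_fun setT (u : X -> R) -> l1l2 G ->
  (forall n x, Omega x -> `|u_ n x| <= G x) ->
  (forall x, Omega x -> u_ n x @[n --> \oo] --> u x) ->
  (forall n, transform_agrees (u_ n)) -> transform_agrees u.
Proof.
move=> mu_ mu0 lG uG cu Pu.
have uG0 x : Omega x -> `|u x| <= G x.
  move=> Ox; apply: (cvgr_to_le (cvg_norm (cu x Ox))).
  by apply: nearW => n; exact: uG.
have luN n : l1l2 (u_ n).
  apply: l1l2_le lG => // x Ox; exact: le_trans (uG n x Ox) (ler_norm _).
have lu : l1l2 u.
  apply: l1l2_le lG => // x Ox; exact: le_trans (uG0 x Ox) (ler_norm _).
have [[TL2P _ TD _] _] := TL2_unitary.
pose h n xi := ((Normc.normc (TL2 (rc (u_ n)) xi - TL2 (rc u) xi)) ^+ 2)%:E.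
have mT v : l1l2 v -> @cmeasurable R _ Xh (TL2 (rc v)).
  by move=> lv; have [[]] := TL2P _ (L2_rc lv).
have mh n : measurable_fun setT (h n : Xh -> \bar R).
  by apply: measurable_normc_sqr; apply: cmeasurableB; exact: mT.
have h0 n xi : (0 <= h n xi)%E by rewrite lee_fin sqr_ge0.
(* Isometry for the difference, written [-1 * u + u_ n] to fit the linearity clause of [unitary]. *)
have hE n : (\int[muh]_xi h n xi = \int[mu]_x ((u_ n x - u x) ^+ 2)%:E)%E.
  have lD := l1l2D (-1) lu (luN n).
  have [_ +] := TL2P _ (L2_rc lD).
  move=> /(congr1 (fun t => t `^ 2)%E); rewrite !L2norm_sqr => E.
  transitivity (\int[mu]_x (Normc.normc (rc (fun x => -1 * u x + u_ n x) x) ^+ 2)%:E)%E.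
    rewrite -E; apply: ge0_ae_eq_integral => //.
    - by apply: measurable_normc_sqr; exact: mT.
    - by move=> x _; rewrite lee_fin sqr_ge0.
    have := TD (-1)%:C _ _ (L2_rc lu) (L2_rc (luN n)).
    have -> : (fun x => (-1)%:C * rc u x + rc (u_ n) x) =
        rc (fun x => -1 * u x + u_ n x).
      by apply/funext => x; rewrite /rc rmorphD rmorphM.
    apply: ae_imp => xi -> _; rewrite /h; congr ((Normc.normc _ ^+ 2)%:E).
    by rewrite rmorphN rmorph1 mulN1r addrC.
  apply: eq_integral => x _; rewrite normc_rc_sqr mulN1r addrC //.
have ch : (\int[muh]_xi h n xi @[n --> \oo] --> 0)%E.
  under eq_fun do rewrite hE.
  (* Both [u_ n] and [u] are bounded by [G] on [Omega], so the square of 2 G dominates the squared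
     differences. *)
  have l2G : l1l2 (fun x => 1 * G x + G x) by exact: l1l2D.
  have [mG2 G2 _] := l2G.
  have iG : mu.-integrable setT (fun x => ((1 * G x + G x) ^+ 2)%:E).
    apply/integrableP; split; first by apply/measurable_EFinP; exact: measurable_funX.
    by under eq_integral do rewrite gee0_abs ?lee_fin ?sqr_ge0//.
  have mf n : measurable_fun setT (fun x : X => ((u_ n x - u x) ^+ 2)%:E).
    by apply/measurable_EFinP; apply: measurable_funX; exact: measurable_funB.
  have cf : {ae mu, forall x, [set: X] x ->
      ((u_ n x - u x) ^+ 2)%:E @[n --> \oo] --> 0%E}.
    apply: (ae_subspace muC) => x Ox _; apply: cvg_EFin; first exact: nearW.
    rewrite [X in _ --> X](_ : _ = (u x - u x) ^+ 2); last by rewrite subrr expr0n.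
    by apply: cvg_sqr; apply: cvgB; [exact: cu|exact: cvg_cst].
  have df : {ae mu, forall x, forall n, [set: X] x ->
      (`|((u_ n x - u x) ^+ 2)%:E| <= ((1 * G x + G x) ^+ 2)%:E)%E}.
    apply: (ae_subspace muC) => x Ox n _.
    rewrite lee_fin ger0_norm ?sqr_ge0// -(real_normK (num_real (_ - _))).
    have GG : `|u_ n x - u x| <= 1 * G x + G x.
      by rewrite mul1r (le_trans (ler_normB _ _))// lerD ?uG ?uG0.
    by apply: lerXn2r => //; rewrite nnegrE// (le_trans _ GG).
  have [_ _ +] := dominated_convergence measurableT mf (measurable_cst _) cf iG df.
  by rewrite integral0.
have A1 := ae_limn_einf0 mh h0 ch.
have A2 := ae_foralln Pu.
have A3 := ae_and A1 A2.
have A4 : {ae muh, forall xi, Omegah xi} by exact: ae_subspace muhC _.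
apply: ae_imp2 A3 A4 => xi -[e0 E] Oxi.
have [mR [cR bR]] := K_Re Oxi; have [mI [cI bI]] := K_Im Oxi.
have cR' := cvg_kernel mu_ mu0 lG uG cu mR bR.
have cI' := cvg_kernel mu_ mu0 lG uG cu mI bI.
pose w := TL2 (rc u) xi; pose t := transform mu K (rc u) xi.
have normcB (a b : R) : Normc.normc ((a +i* b) - w) ^+ 2 =
    (a - complex.Re w) ^+ 2 + (b - complex.Im w) ^+ 2.
  by rewrite normc_sqr !raddfB.
(* At almost every [xi] the sequence converges to |t - w|^2 and has lower limit 0, hence t = w. *)
have ct : h n xi @[n --> \oo] --> (Normc.normc (t - w) ^+ 2)%:E.
  apply: cvg_EFin; first exact: nearW.
  rewrite /t transform_rcE normcB.
  under eq_fun do rewrite /h E transform_rcE normcB.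
  apply: cvgD.
    by apply: cvg_sqr; apply: cvgB; [exact: cR'|exact: cvg_cst].
  by apply: cvg_sqr; apply: cvgB; [exact: cI'|exact: cvg_cst].
have : (Normc.normc (t - w) ^+ 2)%:E = 0%E.
  rewrite -e0 is_cvg_limn_einfE; last by apply/cvg_ex; eexists; exact: ct.
  by rewrite (cvg_lim _ ct).
by move=> [] /eqP; rewrite sqrf_eq0 => /eqP/Normc.eq0_normc/subr0_eq.
Qed.

(** Values outside [Omega] do not matter; this is the limit lemma for a constant sequence. *)
Lemma transform_agrees_eq u v : l1l2 u -> measurable_fun setT (v : X -> R) ->
  (forall x, Omega x -> u x = v x) -> transform_agrees u -> transform_agrees v.
Proof.
move=> lu mv uv Pu; have [mu0 _ _] := lu; have lu' : l1l2 (fun x => `|u x|).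
  apply: (l1l2_le _ _ lu); first exact: measurableT_comp.
  by move=> x _; rewrite normr_id.
apply: (@transform_agrees_lim (fun _ => u) v _ _ mv lu') => //.
by move=> x /uv ->; exact: cvg_cst.
Qed.

Lemma measurable_differentiable (f : 'rV[R]_d -> R) :
  (forall x, differentiable f x) -> measurable_fun setT (f : X -> R).
Proof.
move=> df; apply: measurable_continuous_subspace; apply: continuous_subspaceT => x.
by have := differentiable_continuous (df x).
Qed.

Lemma measurable_schwartz_weight : measurable_fun setT (Phi : X -> R).
Proof. exact: (measurable_differentiable sp_logderiv_weight.1). Qed.

Lemma schwartz_weight_le1 (x : 'rV[R]_d) : Phi x <= 1.
Proof.
apply: prodr_ile1 => i _; rewrite ltW ?sigmoid_bump_gt0//=.
by rewrite (le_trans (sigmoid_bump_le _))// -expR0 ler_expR oppr_le0.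
Qed.

Lemma l1l2_weight : l1l2 Phi.
Proof.
have P0 x := ltW (@schwartz_weight_gt0 R d x).
split; first exact: measurable_schwartz_weight.
  apply: le_lt_trans int_weight; apply: ge0_le_integral_nonmeas => x _.
    by rewrite lee_fin sqr_ge0.
  rewrite lee_fin expr2 ler_wpM2l// (le_trans (schwartz_weight_le1 x))//.
  have e1 : 1 <= 1 + enorm x by rewrite lerDl enorm_ge0.
  by have := ler_powR e1 m_ge0; rewrite powRr0.
by under eq_integral do rewrite ger0_norm//.
Qed.

Lemma agrees_sigmoid_poly p : sigmoid_poly p -> transform_agrees (fun x => p x * Phi x).
Proof.
move=> sp; have [_ TS] := TL2_unitary; apply: TS.
exists (rc (fun x => p x * Phi x)) => //.
have decay k : exists M : R, forall x : 'rV[R]_d, (1 + enorm x) ^+ k * `|Phi x| <= M.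
  have [M MP] := @schwartz_weight_decay R d k; exists M => x.
  by rewrite ger0_norm ?MP// ltW// schwartz_weight_gt0.
split; first exact: rschwartz_sigmoid_poly sp sp_logderiv_weight decay.
(* The imaginary part is 0 times the weight, an instance of the same lemma. *)
have := rschwartz_sigmoid_poly (sp_cst 0) sp_logderiv_weight decay.
by congr rschwartz; apply/funext => x; rewrite mul0r.
Qed.

Let measurable_phi (f : 'rV[R]_d -> R) : measurable_fun setT (f : X -> R) ->
  measurable_fun setT (fun x : X => f x * Phi x).
Proof. by move=> mf; apply: measurable_funM => //; exact: measurable_schwartz_weight. Qed.

Let l1l2_phi (f : 'rV[R]_d -> R) : measurable_fun setT (f : X -> R) ->
  (forall x, `|f x| <= 1) -> l1l2 (fun x => f x * Phi x).
Proof.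
move=> mf f1; apply: l1l2_le l1l2_weight => //; first exact: measurable_phi.
by move=> x _; rewrite normrM ler_piMl.
Qed.

Let lim_phi (f_ : nat -> 'rV[R]_d -> R) (f : 'rV[R]_d -> R) :
  (forall n, measurable_fun setT (f_ n : X -> R)) ->
  measurable_fun setT (f : X -> R) ->
  (forall n x, `|f_ n x| <= 1) ->
  (forall x, f_ n x @[n --> \oo] --> f x) ->
  (forall n, transform_agrees (fun x => f_ n x * Phi x)) -> transform_agrees (fun x => f x * Phi x).
Proof.
move=> mf_ mf f1 cf.
apply: (transform_agrees_lim _ _ l1l2_weight).
- by move=> n; exact: measurable_phi.
- exact: measurable_phi.
- move=> n x _; rewrite normrM [X in _ * X]ger0_norm ?(ltW (schwartz_weight_gt0 x))//.
  by rewrite ler_piMl// ltW// schwartz_weight_gt0.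
- by move=> x _; apply: cvgMl; exact: cf.
Qed.

Let measurable_indicX (B : set 'rV[R]_d) : measurable (B : set (borel 'rV[R]_d)) ->
  measurable_fun setT (\1_B : X -> R).
Proof.
move=> mB; apply: measurable_indic.
by have := @measurable_subspace_id R d Omega measurableT B mB; rewrite setTI.
Qed.

Let indic_le1 (B : set 'rV[R]_d) x : `|\1_B x : R| <= 1.
Proof. by rewrite ger0_norm// indicE; case: (_ \in _). Qed.

(** Dynkin's theorem: the good sets form a lambda-system, and the orthants are good, generate the
    Borel sets and are stable under intersection. *)
Lemma agrees_borel (B : set (borel 'rV[R]_d)) : measurable B ->
  transform_agrees (fun x => \1_B x * Phi x).
Proof.
have mO s : measurable (orthant s : set (borel 'rV[R]_d)).
  have -> : orthant s = \bigcap_(p in [set` s]) [set x | p.2 <= x ord0 p.1].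
    by apply/seteqP; split => x H p; exact: H.
  apply: fin_bigcap_measurable => // p _.
  have := @measurable_rV_coord R d p.1 measurableT [set` `[p.2, +oo[] (measurable_itv _).
  by rewrite setTI; congr measurable; apply/seteqP; split => x /=; rewrite in_itv/= andbT.
(* Measurability is made part of goodness because linearity and the limit lemma require measurable
   functions. *)
pose H : set (set 'rV[R]_d) := [set B | measurable (B : set (borel 'rV[R]_d)) /\
  transform_agrees (fun x => \1_B x * Phi x)].
have lH : lambda_system setT H.
  split => //.
  - split; first exact: measurableT.
    rewrite (_ : (fun _ => _) = (fun x => 1 * Phi x)).
      exact/agrees_sigmoid_poly/sp_cst.
    by apply/funext => x; rewrite indicT.
  - move=> A E EA [mA PA] [mE PE]; split; first exact: measurableD.
    rewrite (_ : (fun _ => _) = (fun x => (-1) * (\1_E x * Phi x) + \1_A x * Phi x)).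
      by apply: (transform_agreesD) => //;
        apply: l1l2_phi => //; exact: measurable_indicX.
    apply/funext => x; rewrite mulN1r addrC -mulrBl; congr (_ * _).
    rewrite !indicE in_setD; have [xE|xE] /= := boolP (x \in E).
      by rewrite (mem_set (EA _ (set_mem xE))) andbF subrr.
    by rewrite andbT subr0.
  - move=> F ndF HF; split; first by apply: bigcupT_measurable => n; exact: (HF n).1.
    apply: (lim_phi (f_ := fun n => \1_(F n))).
    + by move=> n; apply: measurable_indicX; exact: (HF n).1.
    + by apply: measurable_indicX; apply: bigcupT_measurable => n; exact: (HF n).1.
    + by move=> n x; exact: indic_le1.
    + move=> x; rewrite indicE; case: (boolP (x \in _)) => [/set_mem[k _ Fkx]|xF].
        apply: cvg_near_cst; exists k => // n /= kn.
        by rewrite indicE mem_set//; move: Fkx; exact/subsetPset/ndF.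
      rewrite (_ : (fun _ => _) = (fun _ => 0)); first exact: cvg_cst.
      apply/funext => n; rewrite indicE memNset// => Fx.
      by move/negP: xF; apply; apply/mem_set; exists n.
    + by move=> n; exact: (HF n).2.
have GH : range orthant `<=` H.
  move=> _ [s _ <-]; split; first exact: mO.
  (* The indicator of an orthant is the pointwise limit of products of steepening logistic
     functions, each a Schwartz function after multiplication by the weight. *)
  apply: (lim_phi (f_ := sigmoid_orthant s)).
  - move=> n; apply: measurable_differentiable => x.
    exact/sp_differentiable/sp_sigmoid_orthant.
  - by apply: measurable_indicX; exact: mO.
  - by move=> n x; rewrite ger0_norm ?sigmoid_orthant_ge0// sigmoid_orthant_le1.
  - by move=> x; exact: cvg_sigmoid_orthant.
  - by move=> n; exact/agrees_sigmoid_poly/sp_sigmoid_orthant.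
move=> mB.
have [//|_] := lambda_system_subset setI_closed_orthants lH GH _ (measurable_orthants mB).
exact.
Qed.

Lemma agrees_measurable (A : set X) : measurable A ->
  transform_agrees (fun x => \1_A x * Phi x).
Proof.
move=> mA; have [B mB AB] := measurable_subspace_trace mA.
apply: (transform_agrees_eq _ _ _ (agrees_borel mB)).
- by apply: l1l2_phi => //; exact: measurable_indicX.
- by apply: measurable_phi; exact: measurable_indic.
move=> x Ox; congr (_ * _); rewrite !indicE; congr (nat_of_bool _)%:R.
apply/idP/idP => /set_mem xB; apply/mem_set.
  by have [] : (A `&` Omega) x by rewrite AB.
by have [] : (B `&` Omega) x by rewrite -AB.
Qed.

Import HBNNSimple.

Lemma agrees_simple (h : {nnsfun X >-> R}) : transform_agrees (fun x => h x * Phi x).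
Proof.
(* A simple function is such a sum over its range; an arbitrary list of values makes induction
   possible. *)
pose g (r : seq R) (x : X) : R :=
  \sum_(y <- r) y * \1_(h @^-1` [set y]) x.
have mh y : measurable (h @^-1` [set y]) by exact: measurable_sfunP.
have mg r : measurable_fun setT (g r).
  by apply: measurable_sum => y; exact: measurable_funM.
have lI y : l1l2 (fun x => \1_(h @^-1` [set y]) x * Phi x).
  by apply: l1l2_phi => //; exact: measurable_indic.
have lPg : forall r, l1l2 (fun x => g r x * Phi x) /\ transform_agrees (fun x => g r x * Phi x).
  elim => [|y r [lr Pr]].
    have -> : (fun x => g [::] x * Phi x) = (fun x => \1_(set0 : set X) x * Phi x).
      by apply/funext => x; rewrite /g big_nil indic0.
    split; last exact: agrees_measurable.
    by apply: l1l2_phi => //; exact: measurable_indic.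
  have -> : (fun x => g (y :: r) x * Phi x) =
      (fun x => y * (\1_(h @^-1` [set y]) x * Phi x) + g r x * Phi x).
    by apply/funext => x; rewrite /g big_cons mulrDl mulrA.
  split; first exact: l1l2D.
  apply: (transform_agreesD) => //.
  exact: agrees_measurable.
have -> : (fun x => h x * Phi x) =
    (fun x => g (finmap.enum_fset (fset_set (range h))) x * Phi x).
  apply/funext => x; rewrite fimfunE fsbig_finite//.
exact: (lPg _).2.
Qed.

(** Simple functions increase to u / Phi, so their products with [Phi] increase to [u], and [u]
    itself serves as the majorant. *)
Lemma agrees_ge0 u : l1l2 u -> (forall x, 0 <= u x) -> transform_agrees u.
Proof.
move=> lu u0; have [mu_ _ _] := lu.
pose f (x : X) := (u x * (Phi x)^-1)%:E.
have mf : measurable_fun setT f.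
  apply/measurable_EFinP; apply: measurable_funM => //.
  rewrite (_ : (fun _ => _) = (fun r => r `^ (-1)) \o Phi).
    by apply: measurableT_comp => //; exact: measurable_schwartz_weight.
  by apply/funext => x /=; rewrite powR_inv1// ltW// schwartz_weight_gt0.
have f0 x : [set: X] x -> (0 <= f x)%E.
  by move=> _; rewrite lee_fin divr_ge0// ltW// schwartz_weight_gt0.
pose h := nnsfun_approx measurableT mf.
have ch x : h n x @[n --> \oo] --> u x * (Phi x)^-1.
  exact: (fine_cvg (cvg_nnsfun_approx measurableT mf f0 (I : [set: X] x))).
have uE x : u x = u x * (Phi x)^-1 * Phi x.
  by rewrite mulfVK// gt_eqF// schwartz_weight_gt0.
apply: (transform_agrees_lim _ _ lu).
- by move=> n; apply: (measurable_phi (f := h n)); exact: measurable_funP.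
- exact: mu_.
- move=> n x _; rewrite ger0_norm; last first.
    by rewrite mulr_ge0// ltW// schwartz_weight_gt0.
  rewrite [leRHS]uE ler_wpM2r ?(ltW (schwartz_weight_gt0 _))//.
  apply: (cvgr_to_ge (ch x)); exists n => // k /= nk.
  by have /lefP := nd_nnsfun_approx measurableT mf nk; apply.
- by move=> x _; rewrite [X in _ --> X]uE; apply: cvgMl; exact: ch.
- by move=> n; exact: agrees_simple.
Qed.

Lemma transform_agrees_l1l2 u : l1l2 u -> transform_agrees u.
Proof.
move=> lu; have [mu_ _ _] := lu.
have mp : measurable_fun setT (fun x : X => Num.max (u x) 0).
  exact: measurable_maxr.
have mn : measurable_fun setT (fun x : X => Num.max (- u x) 0).
  by apply: measurable_maxr => //; exact: measurableT_comp.
have lp : l1l2 (fun x => Num.max (u x) 0).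
  apply: l1l2_le lu => // x _; case: (leP (u x) 0) => // _; by rewrite normr0.
have ln : l1l2 (fun x => Num.max (- u x) 0).
  apply: l1l2_le lu => // x _; case: (leP (- u x) 0) => // _; by rewrite ?normr0 ?normrN.
rewrite (_ : u = (fun x => (-1) * Num.max (- u x) 0 + Num.max (u x) 0)).
  apply: (transform_agreesD) => //;
    by apply: agrees_ge0 => // x; rewrite le_max lexx orbT.
apply/funext => x; case: (leP (u x) 0) => u0; case: (leP (- u x) 0) => u0'; lra.
Qed.

(** On the ball the weight is at most (1 + r)^m and |u| <= u^2 + 1; the ball has finite mass. *)
Lemma l1l2_ball (u : 'rV[R]_d -> R) (r b : R) : 0 <= r ->
  measurable_fun setT (u : X -> R) -> (\int[mu]_x (u x ^+ 2)%:E < +oo)%E ->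
  (forall x, ~ eball r x -> u x = 0) -> (mu (eball r) <= b%:E)%E ->
  l1l2 u.
Proof.
move=> r0 mu_ u2 ur mub; split => //.
pose B : set X := eball r.
have mB : measurable B by exact: measurable_eball.
apply: (@le_lt_trans _ _ (\int[mu]_x (((1 + r) `^ m)%:E *
    ((u x ^+ 2)%:E + (\1_B x)%:E)))%E).
  apply: ge0_le_integral_nonmeas => x _; first by rewrite lee_fin mulr_ge0// powR_ge0.
  rewrite -EFinD -EFinM lee_fin; have [xB|/ur ->] := pselect (eball r x); last first.
    by rewrite normr0 mul0r expr0n/= add0r mulr_ge0// powR_ge0.
  rewrite mulrC indicE mem_set//= ler_pM ?powR_ge0//.
    apply: ge0_ler_powR => //; rewrite ?nnegrE ?addr_ge0 ?enorm_ge0//.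
    by rewrite lerD2l.
  rewrite -(real_normK (num_real (u x))) -subr_ge0.
  have -> : `|u x| ^+ 2 + 1 - `|u x| = (`|u x| - 2^-1) ^+ 2 + 3 / 4 by field.
  by rewrite addr_ge0 ?sqr_ge0// divr_ge0.
have mu2 : measurable_fun setT (fun x : X => (u x ^+ 2)%:E).
  by apply/measurable_EFinP; exact: measurable_funX.
have m1 : measurable_fun setT (fun x : X => (\1_B x)%:E : \bar R).
  by apply/measurable_EFinP; exact: measurable_indic.
rewrite ge0_integralZl//; first last.
- by rewrite lee_fin powR_ge0.
- by move=> x _; rewrite adde_ge0 ?lee_fin ?sqr_ge0.
- exact: emeasurable_funD.
rewrite lte_mul_pinfty ?lee_fin ?powR_ge0//.
rewrite ge0_integralD//; last by move=> x _; rewrite lee_fin sqr_ge0.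
rewrite lte_add_pinfty// integral_indic// setIT.
by rewrite (le_lt_trans mub)// ltry.
Qed.

(* Cauchy-Schwarz against the indicator function of the ball *)
Lemma integral_kernel_ball (u k : 'rV[R]_d -> R) (r b M : R) : 0 <= r -> 0 <= M ->
  measurable_fun setT (u : X -> R) -> (\int[mu]_x (u x ^+ 2)%:E < +oo)%E ->
  (forall x, ~ eball r x -> u x = 0) -> (mu (eball r) <= b%:E)%E ->
  measurable_fun setT (k : X -> R) ->
  (forall x, Omega x -> eball r x -> `|k x| <= M) ->
  (\int[mu]_x (u x * k x)) ^+ 2 <= M ^+ 2 * b * fine (\int[mu]_x (u x ^+ 2)%:E).
Proof.
move=> r0 M0 mu_ u2 ur mub mk kM.
pose B : set X := eball r.
have mB : measurable B by exact: measurable_eball.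
have mI : measurable_fun setT (\1_B : X -> R) by exact: measurable_indic.
have p2 : 2^-1 + 2^-1 = 1 :> R by field.
have := hoelder mu mu_ mI (ltr0n R 2) (ltr0n R 2) p2.
rewrite Lnorm1.
have aE : ('N[mu]_2%:E[EFin \o u] `^ 2 = \int[mu]_x (u x ^+ 2)%:E)%E.
  rewrite poweR_Lnorm ?pnatr_eq0//; apply: eq_integral => x _ /=.
  by rewrite powR_mulrn// real_normK ?num_real.
have bE : ('N[mu]_2%:E[EFin \o \1_B] `^ 2 = mu B)%E.
  rewrite poweR_Lnorm ?pnatr_eq0// -[B in RHS]setIT -integral_indic//.
  apply: eq_integral => x _ /=.
  rewrite powR_mulrn// real_normK ?num_real// indicE.
  by case: (_ \in _); rewrite ?expr1n ?expr0n.
have b0 : 0 <= b by rewrite -lee_fin (le_trans _ mub).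
have lty_fin (x : \bar R) : (0 <= x)%E -> (x `^ 2 < +oo)%E -> exists2 y, 0 <= y & x = y%:E.
  move=> x0 /lty_poweRy; rewrite pnatr_eq0 => /(_ isT); case: x x0 => [y|//|//] y0 _.
  by exists y.
have [p p0 pE] := lty_fin _ (Lnorm_ge0 _ _ _ : (0 <= 'N[mu]_2%:E[EFin \o u])%E)
  (eq_ind_r (fun z => (z < +oo)%E) u2 aE).
have bfin : (mu B < +oo)%E by rewrite (le_lt_trans mub)// ltry.
have [q q0 qE] := lty_fin _ (Lnorm_ge0 _ _ _ : (0 <= 'N[mu]_2%:E[EFin \o \1_B])%E)
  (eq_ind_r (fun z => (z < +oo)%E) bfin bE).
move: aE bE; rewrite pE qE !poweR_EFin !powR_mulrn// => <- bE /= H.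
have qb : q ^+ 2 <= b by rewrite -lee_fin bE.
(* As [u] vanishes outside the ball, |u k| <= M |u 1_B| on [Omega], and Hölder's inequality
   applies. *)
have Iu : (\int[mu]_x `|(u x * k x)%:E| <= (M * (p * q))%:E)%E.
  rewrite EFinM; apply: (@le_trans _ _ (M%:E * \int[mu]_x `|(u x * \1_B x)%:E|)%E).
    rewrite -ge0_integralZl//; last first.
      by apply/measurable_EFinP/measurableT_comp => //; exact: measurable_funM.
    apply: ae_ge0_le_integral => //.
    - by apply/measurable_EFinP/measurableT_comp => //; exact: measurable_funM.
    - by move=> x _; rewrite mule_ge0.
    - apply: measurable_funeM.
      by apply/measurable_EFinP/measurableT_comp => //; exact: measurable_funM.
    apply: (ae_subspace muC) => x Ox _ /=; rewrite -EFinM lee_fin.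
    have [xB|/ur ->] := pselect (eball r x); last by rewrite !mul0r normr0 mulr0.
    by rewrite indicE mem_set// mulr1 normrM mulrC ler_wpM2r// kM.
  by apply: lee_wpmul2l => //; rewrite lee_fin.
have muk : measurable_fun setT (fun x : X => (u x * k x)%:E).
  by apply/measurable_EFinP; exact: measurable_funM.
have Ik : `|\int[mu]_x (u x * k x)| <= M * (p * q).
  rewrite -lee_fin (le_trans _ Iu)// (le_trans _ (le_abse_integral _ _ muk))//.
  rewrite /Rintegral; by case: (\int[mu]_x _)%E => [y||] //=; rewrite leey.
rewrite -(real_normK (num_real (\int[mu]_x _))).
apply: (@le_trans _ _ ((M * (p * q)) ^+ 2)).
  by apply: lerXn2r => //; rewrite nnegrE !mulr_ge0.
by rewrite /= !exprMn -mulrA ler_wpM2l ?sqr_ge0// mulrC ler_wpM2r ?sqr_ge0.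
Qed.

(** * The uncertainty principle *)

(** A function supported in a ball has real and imaginary parts in [l1l2], so the extension is there
    an integral, and Cauchy-Schwarz bounds it pointwise. Only the values of the kernel between the
    two balls enter. *)
Lemma transform_sup_ball (f : 'rV[R]_d -> R[i]) (r rh b M : R) :
  0 <= r -> 0 <= M -> L2 mu f -> (forall x, ~ eball r x -> f x = 0) ->
  (mu (eball r) <= b%:E)%E ->
  (forall x xi, Omega x -> Omegah xi -> eball r x -> eball rh xi ->
    Normc.normc (K x xi) <= M) ->
  {ae muh, forall xi, eball rh xi ->
    normsq (TL2 f) xi <= 4 * M ^+ 2 * b * fine (\int[mu]_x (normsq f x)%:E)}.
Proof.
move=> r0 M0 [[mRe mIm] /L2norm_lty f2] fr mub KM.
pose u x := complex.Re (f x); pose v x := complex.Im (f x).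
have le2 (w : 'rV[R]_d -> R) : measurable_fun setT (w : X -> R) ->
    (forall x, w x ^+ 2 <= normsq f x) -> (\int[mu]_x (w x ^+ 2)%:E < +oo)%E.
  move=> _ wf; apply: le_lt_trans f2; apply: ge0_le_integral_nonmeas => x _.
    by rewrite lee_fin sqr_ge0.
  by rewrite lee_fin wf.
have u2 : (\int[mu]_x (u x ^+ 2)%:E < +oo)%E.
  by apply: le2 => // x; rewrite normc_sqr lerDl sqr_ge0.
have v2 : (\int[mu]_x (v x ^+ 2)%:E < +oo)%E.
  by apply: le2 => // x; rewrite normc_sqr lerDr sqr_ge0.
have ur x : ~ eball r x -> u x = 0 by move=> /fr; rewrite /u => ->.
have vr x : ~ eball r x -> v x = 0 by move=> /fr; rewrite /v => ->.
have lu : l1l2 u by exact: l1l2_ball ur mub.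
have lv : l1l2 v by exact: l1l2_ball vr mub.
have fE : f = (fun x => (0 +i* 1) * rc v x + rc u x).
  apply/funext => x; rewrite /rc /u /v; case: (f x) => p q; simpc.
  by rewrite ?(mul0r, mul1r, subr0, addr0, add0r).
have [[_ _ TD _] _] := TL2_unitary.
have T1 := TD (0 +i* 1) _ _ (L2_rc lv) (L2_rc lu).
have T2 := transform_agrees_l1l2 lu.
have T3 := transform_agrees_l1l2 lv.
have T4 : {ae muh, forall xi, Omegah xi} by exact: ae_subspace muhC _.
apply: ae_imp2 (ae_and T1 T2) (ae_and T3 T4) => xi -[E1 E2] [E3 Oxi] xir.
have kR x : Omega x -> eball r x -> `|complex.Re (K x xi)| <= M.
  by move=> Ox xr; rewrite (le_trans (Re_le_normc _))// KM.
have kI x : Omega x -> eball r x -> `|complex.Im (K x xi)| <= M.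
  by move=> Ox xr; rewrite (le_trans (Im_le_normc _))// KM.
have [mKR mKI] := K_meas Oxi.
have uR := integral_kernel_ball r0 M0 mRe u2 ur mub mKR kR.
have uI := integral_kernel_ball r0 M0 mRe u2 ur mub mKI kI.
have vR := integral_kernel_ball r0 M0 mIm v2 vr mub mKR kR.
have vI := integral_kernel_ball r0 M0 mIm v2 vr mub mKI kI.
have S : fine (\int[mu]_x (normsq f x)%:E) =
    fine (\int[mu]_x (u x ^+ 2)%:E) + fine (\int[mu]_x (v x ^+ 2)%:E).
  rewrite -fineD ?ge0_fin_numE//; try by apply: integral_ge0 => x _; rewrite lee_fin sqr_ge0.
  congr fine; rewrite -ge0_integralD//; first last.
  - by apply/measurable_EFinP; exact: measurable_funX.
  - by move=> x _; rewrite lee_fin sqr_ge0.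
  - by apply/measurable_EFinP; exact: measurable_funX.
  - by move=> x _; rewrite lee_fin sqr_ge0.
  by apply: eq_integral => x _; rewrite normc_sqr.
rewrite [X in TL2 X]fE E1 E2 E3 !transform_rcE normc_sqr S.
move: uR uI vR vI; rewrite /u /v.
set iuR := Rintegral _ _ _; set iuI := Rintegral _ _ _.
set ivR := Rintegral _ _ _; set ivI := Rintegral _ _ _.
set Su := fine _; set Sv := fine _.
move=> uR uI vR vI; simpc.
(* The squared modulus is (iuR - ivI)^2 + (iuI + ivR)^2, at most twice the sum of the four squares;
   each of [Su] and [Sv] controls two of them, whence the factor 4. *)
have := sqr_ge0 (iuR + ivI); have := sqr_ge0 (iuI - ivR).
rewrite /= !expr2 in uR uI vR vI *; lra.
Qed.

(** Split f = f1 + f2 at radius [r]. For |xi| <= rh, |T f|^2 <= 2 |T f1|^2 + 2 |T f2|^2: the first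
    term integrates to at most half of the left side and is absorbed, the second is controlled by
    the norm of f2 and so by the weight in x. For |xi| > rh the weight in xi suffices. Absorption
    doubles the constants 2 and 1 to 4 and 2. *)
Lemma splitting_inequality (r rh b bh M s beta : R) (f : 'rV[R]_d -> R[i]) :
  0 < r -> 0 < rh -> 0 <= M -> 0 <= s -> 0 <= beta ->
  (mu (eball r) <= b%:E)%E -> (muh (eball rh) <= bh%:E)%E ->
  16 * M ^+ 2 * b * bh <= 1 ->
  (forall x xi, Omega x -> Omegah xi -> eball r x -> eball rh xi ->
    Normc.normc (K x xi) <= M) ->
  L2 mu f ->
  (\int[mu]_x (normsq f x)%:E <=
    (4 * (r `^ s) ^- 2)%:E * \int[mu]_x (Normc.normc ((enorm x `^ s)%:C * f x) ^+ 2)%:E +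
    (2 * (rh `^ beta) ^- 2)%:E *
      \int[muh]_x (Normc.normc ((enorm x `^ beta)%:C * TL2 f x) ^+ 2)%:E)%E.
Proof.
move=> r0 rh0 M0 s0 beta0 mub muhb Mb KM Lf.
have [mf /L2norm_lty f2] := Lf.
set I := (\int[mu]_x (normsq f x)%:E)%E.
set A := (\int[mu]_x _)%E; set B := (\int[muh]_x _)%E.
pose E : set X := eball r; pose Eh : set Xh := eball rh.
have mE : measurable E by exact: measurable_eball.
have mEh : measurable Eh by exact: measurable_eball.
have mIE : measurable_fun setT (\1_E : X -> R) by exact: measurable_indic.
pose f1 x := (\1_E x)%:C * f x; pose f2' x := (1 - \1_E x)%:C * f x.
have cf1 : @cmeasurable R _ X f1 by exact: cmeasurable_rcM.
have cf2 : @cmeasurable R _ X f2'.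
  by apply: cmeasurable_rcM => //; exact: measurable_funB.
have n1 x : normsq f1 x <= normsq f x.
  rewrite normc_sqr_rcM indicE; case: (_ \in _) => /=.
    by rewrite expr1n mul1r.
  by rewrite expr0n mul0r sqr_ge0.
have n2 x : normsq f2' x <= normsq f x.
  rewrite normc_sqr_rcM indicE; case: (_ \in _) => /=.
    by rewrite subrr expr0n mul0r sqr_ge0.
  by rewrite subr0 expr1n mul1r.
have I1 : (\int[mu]_x (normsq f1 x)%:E <= I)%E.
  by apply: ge0_le_integral_nonmeas => x _; rewrite lee_fin ?sqr_ge0.
have I2 : (\int[mu]_x (normsq f2' x)%:E <= I)%E.
  by apply: ge0_le_integral_nonmeas => x _; rewrite lee_fin ?sqr_ge0.
have L1 : L2 mu f1 by split => //; apply/L2norm_lty; exact: le_lt_trans f2.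
have L2' : L2 mu f2' by split => //; apply/L2norm_lty; exact: le_lt_trans f2.
have [[TL2P _ TD _] _] := TL2_unitary.
have fE : f = (fun x => 1 * f1 x + f2' x).
  by apply/funext => x; rewrite /f1 /f2' mul1r -mulrDl -rmorphD subrKC rmorph1 mul1r.
have T1 := TD 1 _ _ L1 L2'.
have f1r x : ~ eball r x -> f1 x = 0.
  by move=> xr; rewrite /f1 indicE memNset// mul0r.
have T2 := transform_sup_ball
  (ltW r0) M0 L1 f1r mub KM.
set S := fine _ in T2.
have If : I \is a fin_num.
  by rewrite ge0_fin_numE// integral_ge0// => x _; rewrite lee_fin sqr_ge0.
have SI : S <= fine I.
  rewrite fine_le// ge0_fin_numE; first exact: le_lt_trans I1 f2.
  by apply: integral_ge0 => x _; rewrite lee_fin sqr_ge0.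
have S0 : 0 <= S.
  by apply: fine_ge0; apply: integral_ge0 => x _; rewrite lee_fin sqr_ge0.
pose c0 := 4 * M ^+ 2 * b * S.
have b0 : 0 <= b by rewrite -lee_fin (le_trans _ mub).
have bh0 : 0 <= bh by rewrite -lee_fin (le_trans _ muhb).
have c00 : 0 <= c0 by rewrite !mulr_ge0 ?sqr_ge0.
have [cTf _] := (TL2P _ Lf).1; have [cTf2 _] := (TL2P _ L2').1.
have IE : (I = \int[muh]_x (normsq (TL2 f) x)%:E)%E.
  by rewrite /I -!L2norm_sqr (TL2P _ Lf).2.
have I2E : (\int[mu]_x (normsq f2' x)%:E = \int[muh]_x (normsq (TL2 f2') x)%:E)%E.
  by rewrite -!L2norm_sqr (TL2P _ L2').2.
have kh0 : 0 <= (rh `^ beta) ^- 2 by rewrite invr_ge0 exprn_ge0// powR_ge0.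
have k0 : 0 <= (r `^ s) ^- 2 by rewrite invr_ge0 exprn_ge0// powR_ge0.
have mT2 := measurable_normc_sqr cTf2.
have mTw := measurable_normc_sqr (cmeasurable_enorm_powR beta cTf).
have mIh : measurable_fun setT (fun x : Xh => (\1_Eh x)%:E : \bar R).
  by apply/measurable_EFinP; exact: measurable_indic.
have p1 x : (0 <= (2 * c0)%:E * (\1_Eh x)%:E :> \bar R)%E.
  by rewrite -EFinM lee_fin !mulr_ge0.
have p2 x : (0 <= 2%:E * (normsq (TL2 f2') x)%:E :> \bar R)%E.
  by rewrite -EFinM lee_fin mulr_ge0 ?sqr_ge0.
have p3 x : (0 <= ((rh `^ beta) ^- 2)%:E *
    (Normc.normc ((enorm x `^ beta)%:C * TL2 f x) ^+ 2)%:E :> \bar R)%E.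
  by rewrite -EFinM lee_fin mulr_ge0 ?sqr_ge0.
have Ih : (I <= (2 * c0 * bh)%:E + 2%:E * \int[mu]_x (normsq f2' x)%:E +
    ((rh `^ beta) ^- 2)%:E * B)%E.
  rewrite IE I2E; apply: (@le_trans _ _ (\int[muh]_x ((2 * c0)%:E * (\1_Eh x)%:E +
     2%:E * (normsq (TL2 f2') x)%:E + ((rh `^ beta) ^- 2)%:E *
     (Normc.normc ((enorm x `^ beta)%:C * TL2 f x) ^+ 2)%:E))%E).
    apply: ae_ge0_le_integral => //.
    - by move=> x _; rewrite lee_fin sqr_ge0.
    - exact: measurable_normc_sqr.
    - by move=> x _; rewrite !adde_ge0 ?p1 ?p2 ?p3.
    - apply: emeasurable_funD; last exact: measurable_funeM.
      by apply: emeasurable_funD; exact: measurable_funeM.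
    apply: ae_imp2 T1 T2 => xi E1 E2 _.
    rewrite -!EFinM -!EFinD lee_fin normc_sqr_rcM.
    have [xr|xr] := pselect (eball rh xi).
      rewrite indicE mem_set// mulr1 -[leLHS]addr0.
      apply: lerD; last exact: mulr_ge0 kh0 (mulr_ge0 (sqr_ge0 _) (sqr_ge0 _)).
      rewrite {1}fE E1 mul1r (le_trans (normc_sqrD _ _))// lerD2r ler_wpM2l//.
      exact: E2.
    rewrite indicE memNset// mulr0 add0r -[leLHS]add0r; apply: lerD.
      exact: mulr_ge0 (ler0n R 2) (sqr_ge0 _).
    rewrite mulrA ler_peMl ?sqr_ge0//.
    exact: powR_weight_ge1.
  rewrite ge0_integralD//; first last.
  - exact: measurable_funeM.
  - by apply: emeasurable_funD; exact: measurable_funeM.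
  - by move=> x _; rewrite adde_ge0 ?p1 ?p2.
  rewrite ge0_integralD//; first last.
  - exact: measurable_funeM.
  - exact: measurable_funeM.
  rewrite !ge0_integralZl//; do ?[by move=> x _; rewrite lee_fin sqr_ge0];
    do ?[by rewrite lee_fin mulr_ge0].
  apply: leeD => //; apply: leeD => //; rewrite [leRHS]EFinM.
  apply: lee_wpmul2l; first by rewrite lee_fin mulr_ge0.
  by rewrite integral_indic// setIT.
have I2A : (\int[mu]_x (normsq f2' x)%:E <= ((r `^ s) ^- 2)%:E * A)%E.
  rewrite /A -ge0_integralZl//; first last.
  - by move=> x _; rewrite lee_fin sqr_ge0.
  - exact: measurable_normc_sqr (cmeasurable_enorm_powR s mf).
  apply: ge0_le_integral_nonmeas => x _; first by rewrite lee_fin sqr_ge0.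
  rewrite -EFinM lee_fin !normc_sqr_rcM indicE.
  have [xr|xr] := pselect (eball r x).
    rewrite mem_set// subrr expr0n mul0r.
    exact: mulr_ge0 k0 (mulr_ge0 (sqr_ge0 _) (sqr_ge0 _)).
  rewrite memNset// subr0 expr1n [leRHS]mulrA ler_wpM2r ?sqr_ge0//.
  exact: powR_weight_ge1.
have A0 : (0 <= A)%E by apply: integral_ge0 => x _; rewrite lee_fin sqr_ge0.
have B0 : (0 <= B)%E by apply: integral_ge0 => x _; rewrite lee_fin sqr_ge0.
have kgt : (0 < (4 * (r `^ s) ^- 2)%:E :> \bar R)%E.
  by rewrite lte_fin mulr_gt0// invr_gt0 exprn_gt0// powR_gt0.
have khgt : (0 < (2 * (rh `^ beta) ^- 2)%:E :> \bar R)%E.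
  by rewrite lte_fin mulr_gt0// invr_gt0 exprn_gt0// powR_gt0.
have {}Ih := le_trans Ih (leeD (leeD (lexx _)
  (lee_wpmul2l (_ : 0 <= 2%:E)%E I2A)) (lexx _)).
move: Ih; rewrite lee_fin => /(_ (ler0n R 2)).
clearbody A B => {}Ih.
(* If a weighted integral is infinite the right side is infinite; otherwise everything is real. *)
case: A A0 Ih I2A => [A| |] // A0 Ih _; last first.
  rewrite (gt0_muley kgt) addye ?leey//.
  by rewrite gt_eqF// (lt_le_trans _ (mule_ge0 (ltW khgt) B0)).
case: B B0 Ih => [B| |] // B0 Ih; last by rewrite (gt0_muley khgt) addey ?leey// -EFinM.
move: Ih; rewrite -(fineK If) -!EFinM -!EFinD !lee_fin.
(* Here 2 c0 bh = 8 M^2 b bh S, which the smallness hypothesis bounds by S / 2. *)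
have : 2 * c0 * bh <= fine I / 2.
  have : 16 * M ^+ 2 * b * bh * S <= 1 * S by rewrite ler_wpM2r.
  by rewrite /c0; lra.
lra.
Qed.

End transform.

(** * Vanishing weighted norms and choice of the dilation *)

Section null_origin.
Context {R : realType} {d : nat}.
Variables (Omega : set 'rV[R]_d).
Variables (mu : {measure set (borel (subspace Omega)) -> \bar R}).

(** Settles the case of a vanishing weighted norm, where no optimal dilation exists: the weight is
    zero only on the null set [eball 0], so [f] vanishes almost everywhere. *)
Lemma L2norm_enorm_eq0 (s : R) (f : 'rV[R]_d -> R[i]) :
  mu (eball 0) = 0%E -> @cmeasurable R _ (borel (subspace Omega)) f ->
  L2norm mu (fun x => (enorm x `^ s)%:C * f x) = 0%E ->
  (L2norm mu f `^ 2 = 0)%E.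
Proof.
move=> mu0 mf /(congr1 (fun t => t `^ 2)%E).
rewrite !L2norm_sqr poweR_EFin powR0 ?pnatr_eq0// => I0.
have mg := measurable_normc_sqr (cmeasurable_enorm_powR s mf).
have /(ae_eq_integral_abs mu measurableT mg) g0 :
    (\int[mu]_x `|(Normc.normc ((enorm x `^ s)%:C * f x) ^+ 2)%:E| = 0)%E.
  by rewrite -[RHS]I0; apply: eq_integral => x _; rewrite gee0_abs ?lee_fin ?sqr_ge0.
have n0 : {ae mu, forall x : borel (subspace Omega), ~ eball 0 x}.
  exists (eball 0); split => //; first exact: measurable_eball.
  by move=> x /= /notP.
rewrite (ge0_ae_eq_integral (g := cst 0%E))//.
- by rewrite integral0.
- exact: measurable_normc_sqr.
- by move=> x _; rewrite lee_fin sqr_ge0.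
apply: ae_imp2 g0 n0 => x /(_ I) [].
rewrite normc_sqr_rcM => /eqP; rewrite mulf_eq0 => /orP[|/eqP-> //].
rewrite sqrf_eq0 => /eqP/powR_eq0_eq0 e0 nx _; exfalso; apply: nx.
by rewrite /eball/= e0.
Qed.

End null_origin.

(* The minimising dilation parameter is [(A / B) `^ (s + beta)^-1]. *)
Lemma optimize_dilation {R : realType} (A B S c1 c2 s beta : R) :
  0 < A -> 0 < B -> 0 < s -> 0 < beta ->
  (forall t, 0 < t -> S <= c1 * ((t `^ s) ^- 2 * A ^+ 2) +
                           c2 * ((t `^ beta) ^+ 2 * B ^+ 2)) ->
  S <= (c1 + c2) * (A `^ (2 * beta / (s + beta)) * B `^ (2 * s / (s + beta))).
Proof.
move=> A0 B0 s0 b0 H.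
have sb0 : s + beta != 0 by rewrite gt_eqF// addr_gt0.
(* In logarithmic coordinates both terms become the exponential of the same linear form in x and
   y. *)
pose x := ln A; pose y := ln B.
have AE : A = expR x by rewrite lnK.
have BE : B = expR y by rewrite lnK.
have := H (expR ((x - y) / (s + beta))) (expR_gt0 _).
rewrite AE BE -!expRM_natl -!expRM -!expRM_natl -!expRN -!expRD.
have -> : - (2 * ((x - y) / (s + beta) * s)) + 2 * x =
   x * (2 * beta / (s + beta)) + y * (2 * s / (s + beta)) by field.
have -> : 2 * ((x - y) / (s + beta) * beta) + 2 * y =
   x * (2 * beta / (s + beta)) + y * (2 * s / (s + beta)) by field.
by rewrite -mulrDl.
Qed.

Theorem theoremC (R : realType) (d : nat) (Omega Omegah : set 'rV[R]_d)
  (mu : {measure set (borel (subspace Omega)) -> \bar R})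
  (muh : {measure set (borel (subspace Omegah)) -> \bar R})
  (a ah m mh : R) (Q Qh : 'rV[R]_d -> R)
  (K : 'rV[R]_d -> 'rV[R]_d -> R[i])
  (TL2 : ('rV[R]_d -> R[i]) -> ('rV[R]_d -> R[i]))
  (cone_Omega : convex_cone Omega) (cone_Omegah : convex_cone Omegah)
  (int_Omega : interior Omega !=set0) (int_Omegah : interior Omegah !=set0)
  (a_gt0 : 0 < a) (ah_eq : ah = a)
  (dens_Q : angular_density Q) (dens_Qh : angular_density Qh)
  (ac_mu : abs_continuous mu) (ac_muh : abs_continuous muh)
  (polar_mu : polar_decomposition mu a Q)
  (polar_muh : polar_decomposition muh ah Qh)
  (m_ge0 : 0 <= m) (mh_ge0 : 0 <= mh)
  (K_cont : ccontinuous_within (Omega `*` Omegah) (fun p => K p.1 p.2))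
  (K_poly : polynomially_bounded Omega Omegah K m mh)
  (K_homo : homogeneous_kernel Omega Omegah K)
  (K_inv : inversion_formula mu muh K m mh)
  (K_planch : plancherel mu muh K TL2)
  (s beta : R) (s_gt0 : 0 < s) (beta_gt0 : 0 < beta) :
  exists2 C : R, 0 < C &
    forall f : 'rV[R]_d -> R[i], L2 mu f ->
      (L2norm mu (fun x => (enorm x `^ s)%R%:C * f x)%R
         `^ (2 * beta / (s + beta))
       * L2norm muh (fun xi => (enorm xi `^ beta)%R%:C * TL2 f xi)%R
           `^ (2 * s / (s + beta))
       >= C%:E * L2norm mu f `^ 2)%E.
Proof.
subst ah.
have [C C0 mub] := polar_measure_eball a_gt0 dens_Q polar_mu.
have [Ch Ch0 muhb] := polar_measure_eball a_gt0 dens_Qh polar_muh.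
have muC := polar_measure_setC polar_mu; have muhC := polar_measure_setC polar_muh.
have [c Kc] := K_poly; have [_ TL2_unitary _] := K_planch.
have [cK1 cK2] := K_cont.
have K_meas xi : Omegah xi -> @cmeasurable R _ (borel (subspace Omega)) (K^~ xi).
  move=> Oxi; split; apply: measurable_continuous_subspace.
    exact: (continuous_within_section cK1 Oxi).
  exact: (continuous_within_section cK2 Oxi).
have K_bound xi : Omegah xi -> exists c : R, forall x, Omega x ->
    Normc.normc (K x xi) <= c * (1 + enorm x) `^ m.
  move=> Oxi; exists (c * (1 + enorm xi) `^ mh) => x Ox.
  by rewrite mulrAC Kc.
have int_weight := integral_schwartz_weight C0 mub m.
(* Bounds the kernel when |x| and |xi| are at most 1, as both weights are then at most 2; the sign
   of [c] is unknown. *)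
pose M := `|c| * 2 `^ m * 2 `^ mh.
have M0 : 0 <= M by rewrite !mulr_ge0 ?powR_ge0.
(* The balls of radii t eta and eta / t have masses at most C (t eta)^(2a) and Ch (eta / t)^(2a), so
   the smallness condition reads D eta^(4a) <= 1 for every t. *)
pose D := 16 * M ^+ 2 * C * Ch.
have D0 : 0 <= D by rewrite !mulr_ge0 ?sqr_ge0.
have D1 : 0 < D + 1 by rewrite ltr_wpDl.
(* Chosen so that eta^(4a) = 1 / (D + 1); adding 1 also gives eta <= 1 and covers D = 0. *)
pose eta := (D + 1)^-1 `^ (4 * a)^-1.
have eta0 : 0 < eta by rewrite powR_gt0// invr_gt0.
have a4 : 4 * a != 0 by rewrite mulf_neq0// gt_eqF.
have eta1 : eta <= 1.
  have -> : 1 = 1 `^ (4 * a)^-1 :> R by rewrite powR1.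
  apply: ge0_ler_powR.
  - by rewrite invr_ge0 mulr_ge0// ltW.
  - by rewrite nnegrE invr_ge0 ltW.
  - by rewrite nnegrE.
  - by rewrite invf_le1// lerDr.
have etaD : (eta ^+ 2) `^ (2 * a) = (D + 1)^-1.
  rewrite -powR_mulrn ?ltW// -!powRrM.
  by rewrite (_ : _ * _ = 1) ?powRr1 ?invr_ge0 ?ltW//; field; rewrite gt_eqF.
(* Homogeneity gives K(x, xi) = K(x / t, t xi), and both new arguments have norm at most eta, so the
   bound does not depend on t. *)
have bound t x xi : 0 < t -> Omega x -> Omegah xi -> eball (t * eta) x ->
    eball (eta / t) xi -> Normc.normc (K x xi) <= M.
  move=> t0 Ox Oxi xr xir.
  have Otx : Omega (t^-1 *: x) by apply: cone_Omega.2 => //; rewrite invr_gt0.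
  have Otxi : Omegah (t *: xi) by exact: cone_Omegah.2.
  rewrite -[x in K x](scalerKV (lt0r_neq0 t0)) K_homo//.
  have le_powR2 (y : 'rV[R]_d) p : 0 <= p -> enorm y <= eta -> (1 + enorm y) `^ p <= 2 `^ p.
    move=> p0 yeta; apply: ge0_ler_powR => //.
    - by rewrite nnegrE addr_ge0// enorm_ge0.
    - by rewrite nnegrE.
    - by rewrite (_ : 2 = 1 + 1)// lerD2l (le_trans yeta).
  apply: le_trans (Kc _ _ Otx Otxi) _; rewrite /M -!mulrA.
  apply: le_trans (ler_wpM2r (mulr_ge0 (powR_ge0 _ _) (powR_ge0 _ _)) (ler_norm c)) _.
  rewrite ler_wpM2l//; apply: ler_pM; rewrite ?powR_ge0//.
    apply: le_powR2 => //; rewrite enormZ ?invr_ge0 ?(ltW t0)//.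
    by rewrite ler_pdivrMl.
  apply: le_powR2 => //; rewrite enormZ ?(ltW t0)//.
  by rewrite mulrC -ler_pdivlMr.
have a2 : 2 * a != 0 by rewrite mulf_neq0// gt_eqF.
have mu0 : mu (eball 0) = 0%E.
  apply/eqP; rewrite eq_le measure_ge0 andbT (le_trans (mub 0 (lexx 0)))//.
  by rewrite powR0// mulr0.
have muh0 : muh (eball 0) = 0%E.
  apply/eqP; rewrite eq_le measure_ge0 andbT (le_trans (muhb 0 (lexx 0)))//.
  by rewrite powR0// mulr0.
pose c1 := 4 * (eta `^ s) ^- 2; pose c2 := 2 * (eta `^ beta) ^- 2.
have c10 : 0 < c1 by rewrite mulr_gt0// invr_gt0 exprn_gt0// powR_gt0.
have c20 : 0 < c2 by rewrite mulr_gt0// invr_gt0 exprn_gt0// powR_gt0.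
(* [optimize_dilation] bounds the squared norm by c1 + c2 times the product of powers. *)
exists (c1 + c2)^-1; first by rewrite invr_gt0 addr_gt0.
move=> f Lf; have [mf _] := Lf.
have [[TL2P _ _ _] _] := TL2_unitary.
have [[mTf _] NE] := TL2P _ Lf.
set A := L2norm mu (fun x => (enorm x `^ s)%:C * f x).
set B := L2norm muh (fun x => (enorm x `^ beta)%:C * TL2 f x).
set p := 2 * beta / _; set q := 2 * s / _.
have sb0 : 0 < s + beta by rewrite addr_gt0.
have p0 : p != 0 by rewrite gt_eqF// divr_gt0// mulr_gt0.
have q0 : q != 0 by rewrite gt_eqF// divr_gt0// mulr_gt0.
have A0 : (0 <= A)%E by exact: L2norm_ge0.
have B0 : (0 <= B)%E by exact: L2norm_ge0.
(* The zero cases come first because 0 times infinity is 0: an infinite norm below then meets a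
   positive factor. If B = 0, the transform vanishes almost everywhere, and so does [f] by
   isometry. *)
have [A_eq0|A_neq0] := eqVneq A 0%E.
  by rewrite (L2norm_enorm_eq0 mu0 mf A_eq0) mule0 mule_ge0// poweR_ge0.
have [B_eq0|B_neq0] := eqVneq B 0%E.
  by rewrite -NE (L2norm_enorm_eq0 muh0 mTf B_eq0) mule0 mule_ge0// poweR_ge0.
have pos (e : \bar R) r : (0 <= e)%E -> e != 0%E -> (0 < e `^ r)%E.
  by move=> e0 en0; rewrite poweR_gt0// lt0e en0.
have split t : 0 < t -> (L2norm mu f `^ 2 <=
    (c1 * (t `^ s) ^- 2)%:E * A `^ 2 + (c2 * (t `^ beta) ^+ 2)%:E * B `^ 2)%E.
  move=> t0; rewrite !L2norm_sqr.
  have te0 : 0 < t * eta by rewrite mulr_gt0.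
  have et0 : 0 < eta / t by rewrite divr_gt0.
  have small : 16 * M ^+ 2 * (C * (t * eta) `^ (2 * a)) *
      (Ch * (eta / t) `^ (2 * a)) <= 1.
    rewrite (_ : _ * _ = D * ((t * eta) `^ (2 * a) * (eta / t) `^ (2 * a))); last first.
      by rewrite /D; ring.
    rewrite -powRM ?(ltW te0) ?(ltW et0)//.
    rewrite (_ : t * eta * (eta / t) = eta ^+ 2); last by field; rewrite gt_eqF.
    by rewrite etaD ler_pdivrMr// mul1r lerDl.
  have := splitting_inequality muC muhC K_meas K_bound TL2_unitary m_ge0 int_weight
    te0 et0 M0 (ltW s_gt0) (ltW beta_gt0) (mub _ (ltW te0)) (muhb _ (ltW et0))
    small (fun x xi => @bound t x xi t0) Lf.
  (* Separates the powers of eta, which go into [c1] and [c2], from those of t. *)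
  congr (_ <= _ %:E * _ + _ %:E * _)%E.
    by rewrite /c1 powRM ?(ltW t0) ?(ltW eta0)// exprMn invfM; ring.
  have tb : t `^ beta != 0 by rewrite gt_eqF// powR_gt0.
  have -> : (eta / t) `^ beta = eta `^ beta / t `^ beta.
    apply: (mulIf tb); rewrite divfK// -powRM ?(ltW et0) ?(ltW t0)//.
    by rewrite divfK// gt_eqF.
  by rewrite /c2 exprMn invfM exprVn invrK mulrA.
case: A A0 A_neq0 split => [A| |]// A0 A_neq0 split; last first.
  by rewrite poweRyr// gt0_mulye ?leey// pos.
case: B B0 B_neq0 split => [B| |]// B0 B_neq0 split; last first.
  by rewrite poweRyr// gt0_muley ?leey// pos.
have A_gt0 : 0 < A by rewrite lt0r -eqe A_neq0.
have B_gt0 : 0 < B by rewrite lt0r -eqe B_neq0.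
have Nfin : (L2norm mu f `^ 2)%E \is a fin_num.
  rewrite ge0_fin_numE ?poweR_ge0//; apply: poweR_lty; exact: Lf.2.
rewrite -(fineK Nfin) !poweR_EFin -!EFinM lee_fin ler_pdivrMl ?addr_gt0//.
apply: optimize_dilation => // t t0.
have := split t t0; rewrite -[X in (X <= _)%E](fineK Nfin) !poweR_EFin.
rewrite !powR_mulrn ?(ltW A_gt0) ?(ltW B_gt0)//.
by rewrite -!EFinM -EFinD lee_fin !mulrA.
Qed.
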